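(* Let $m,n\in\mathbb{Z}_{\ge0}$, $d_2=q^{-m}$, $d_3=q^{-n}$, and let $q,t,d_1,d_4,Q^\vee$ be generic. Let $Y(\Lambda,Q^\vee)=(Y_{i,j}(\Lambda,Q^\vee))_{-n\le i,j\le m}$ be the normalized fundamental solution (defined in the context) of the $q$-KZ equation in $\Lambda$. Then $Y$ also satisfies the following equation with respect to $Q^\vee$: for all $-n\le i,k\le m$, $$\sum_{j=-n}^mY_{i,j}\Big(\Lambda,\frac{Q^\vee}{t}\Big)\Big(\frac{\Lambda d_1}{q^{m+2}}\Big)^{j}\tilde r_{j,k}(Q^\vee)=v_i(\Lambda,Q^\vee)\,Y_{i,k}(\Lambda,Q^\vee),$$ where $\tilde r_{i,j}(Q^\vee)=r_{i,j}(\Lambda)\big|_{\Lambda\mapsto\frac{q^{m+2}}{d_1}Q^\vee}$ and $$v_i(\Lambda,Q^\vee)=q^{i(i+1)}\Big(\frac{\Lambda d_1}{q^{m+2}}\Big)^i\frac{(Q^\vee q^{2+2i};q)_{m-i}\,(d_4Q^\vee q^{1-n};q)_{n+i}}{(d_1^{-1}Q^\vee q^{2+i};q)_{m-i}\,(Q^\vee q^{1-n+i};q)_{n+i}}.$$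
   Context: $(a;q)_k=\prod_{s=0}^{k-1}(1-aq^s)$, $\varphi(z)=(z;q)_\infty$, and $\mathcal B\,x^k=q^{k(k+1)/2}x^k$. Let $$\mathcal{H}_{\mathrm S}=\frac{1}{\varphi(qx)\varphi(\Lambda/x)}\cdot\mathcal{B}\cdot\frac{\varphi(\Lambda)\,\varphi(q^{-1}d_1d_2d_3d_4\Lambda)}{\varphi(-d_1x)\varphi(-d_2x)\varphi(-d_3\Lambda/x)\varphi(-d_4\Lambda/x)}\cdot\mathcal{B}\cdot\frac{1}{\varphi(q^{-1}d_1d_2x)\varphi(d_3d_4\Lambda/x)}$$ (all factors expanded in $x$ and $\Lambda/x$). When $d_2=q^{-m}$, $d_3=q^{-n}$ one has $\mathcal{H}_{\mathrm S}x^i=\sum_{j=-n}^mr_{i,j}(\Lambda)x^j$ for $-n\le i\le m$, with $r_{i,j}(\Lambda)$ rational in $\Lambda$, independent of $Q^\vee$ and $t$; $r_{i,j}(0)$ is upper triangular with $r_{i,i}(0)=q^{i(i+1)}$. The normalized fundamental solution $Y_{i,j}(\Lambda,Q^\vee)$ is the matrix of formal power series in $\Lambda$ with $Y_{i,j}(0,Q^\vee)$ upper triangular, $Y_{i,i}(0,Q^\vee)=1$, and $$Y_{k,j}(\Lambda,Q^\vee)=\sum_{i=-n}^m(Q^\vee)^{-k}q^{-k(k+1)}\,Y_{k,i}\Big(\frac{\Lambda}{t},Q^\vee\Big)(Q^\vee)^i\,r_{i,j}(\Lambda),\qquad -n\le k,j\le m.$$ (In the paper $Q^\vee=(qtQ)^{-1}$.)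 *)

(* Defs.v *)
From mathcomp Require Import all_boot all_order all_algebra.
From mathcomp Require Import ring zify.
From Stdlib Require ClassicalEpsilon.

Set Implicit Arguments.
Unset Strict Implicit.
Unset Printing Implicit Defensive.

Import Order.TTheory GRing.Theory Num.Theory.
Local Open Scope ring_scope.

(* Generic parameters: nonzero and multiplicatively independent.  This holds
   outside countably many hypersurfaces, in particular for algebraically
   independent parameters. *)
Definition generic (F : fieldType) (q t d1 d4 Q : F) : Prop :=
  [/\ q != 0, t != 0, d1 != 0, d4 != 0 & Q != 0] /\
  forall a b c d e : int,
    q ^ a * t ^ b * d1 ^ c * d4 ^ d * Q ^ e = 1 ->
    [/\ a = 0, b = 0, c = 0, d = 0 & e = 0].

Definition qpoch (F : fieldType) (a q : F) (k : nat) : F :=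
  \prod_(s < k) (1 - a * q ^+ s).

(* Coefficients of z^k in phi(z) = (z;q)_oo and in 1/phi(z), by Euler's
   identities; see qpoch_coef (the coefficients of (z;q)_N tend to phi_coef as
   q^N -> 0) and phi_coefV. *)
Definition phi_coef (F : fieldType) (q : F) (k : nat) : F :=
  (-1) ^+ k * q ^+ 'C(k, 2) / qpoch q q k.

Definition phiV_coef (F : fieldType) (q : F) (k : nat) : F :=
  (qpoch q q k)^-1.

Lemma qpoch_neq0 (F : fieldType) (q : F) (k : nat) :
  (forall l : nat, (0 < l)%N -> q ^+ l != 1) -> qpoch q q k != 0.
Proof.
move=> hq; apply/prodf_neq0 => s _.
by rewrite -exprS subr_eq0 eq_sym hq.
Qed.

Lemma qpoch_coef (F : fieldType) (q : F) (N k : nat) :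
  (forall l : nat, (0 < l)%N -> q ^+ l != 1) ->
  (\prod_(s < N) (1 - (q ^+ s)%:P * 'X))`_k =
    phi_coef q k * \prod_(s < k) (1 - q ^+ (N - s)).
Proof.
move=> hq; elim: N k => [|N IH] [|k].
- by rewrite /phi_coef /qpoch !big_ord0 coef1 ?mulr1 ?invr1 expr0 ?mulr1.
- by rewrite big_ord0 coef1 big_ord_recl subrr mul0r mulr0.
- rewrite big_ord_recr /= mulrBr mulr1 coefB IH mulrA coefMX /= subr0.
  by rewrite !big_ord0.
rewrite big_ord_recr /= mulrBr mulr1 coefB mulrA coefMX /= coefMC !IH.
rewrite big_ord_recr [X in _ = _ * X]big_ord_recl /= subn0.
under [X in _ = _ * (_ * X)]eq_bigr => s _ do rewrite /bump /= add1n subSS.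
set A := \prod_(i < k) _.
have [lekN|ltNk] := leqP k N; last first.
  suff -> : A = 0 by ring.
  by rewrite /A (bigD1 (Ordinal ltNk)) //= subnn subrr mul0r.
have cS : phi_coef q k.+1 * (1 - q ^+ k.+1) = - (q ^+ k * phi_coef q k).
  have := qpoch_neq0 k.+1 hq; rewrite /phi_coef /qpoch big_ord_recr /= -exprS.
  rewrite mulf_eq0 negb_or => /andP[h1 h2].
  by rewrite binS bin1 exprD !exprS; field; rewrite -exprS h1 h2.
have eN : q ^+ N = q ^+ (N - k) * q ^+ k by rewrite -exprD subnK.
have e1 : phi_coef q k * A * q ^+ N =
    - (phi_coef q k.+1 * (1 - q ^+ k.+1)) * A * q ^+ (N - k).
  by rewrite cS eN; ring.
by rewrite e1 !exprS eN; ring.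
Qed.

Lemma phi_coefV (F : fieldType) (q : F) (N : nat) :
  (forall l : nat, (0 < l)%N -> q ^+ l != 1) ->
  \sum_(k < N.+1) phi_coef q k * phiV_coef q (N - k) = (N == 0)%:R.
Proof.
move=> hq; case: N => [|N].
  by rewrite big_ord1 /phi_coef /phiV_coef /qpoch big_ord0 !mul1r !invr1 mulr1.
set p : {poly F} := \prod_(s < N.+1) (1 - (q ^+ s)%:P * 'X).
have p1 : p.[1] = 0.
  by rewrite /p big_ord_recl hornerM !hornerE ?expr0 ?mulr1 subrr mul0r.
have sp : (size p <= N.+2)%N.
  apply/leq_sizeP => j leNj; rewrite /p qpoch_coef //.
  by rewrite (bigD1 (Ordinal leNj)) //= subnn subrr mul0r mulr0.
apply: (mulIf (qpoch_neq0 N.+1 hq)); rewrite mul0r -[RHS]p1.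
rewrite (horner_coef_wide _ sp) mulr_suml; apply: eq_bigr => -[k /= lek] _.
rewrite expr1n mulr1 /p qpoch_coef // -mulrA; congr (_ * _).
apply: (mulfI (qpoch_neq0 (N.+1 - k) hq)).
rewrite mulrA divff ?qpoch_neq0 // mul1r.
have -> : \prod_(s < k) (1 - q ^+ (N.+1 - s)) =
    \prod_(N.+1 - k <= s < N.+1) (1 - q * q ^+ s).
  rewrite -{1}(add0n (N.+1 - k)%N) big_addn subKn // big_nat_rev add0n.
  rewrite big_mkord; apply: eq_bigr => -[s /= ltsk] _; rewrite -exprS.
  by congr (1 - q ^+ _); lia.
rewrite /qpoch -!(big_mkord xpredT (fun s => 1 - q * q ^+ s)).
by rewrite -big_cat_nat //= leq_subr.
Qed.

(* f : nat -> F is the power series \sum_N f N * Lambda^N. *)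
Definition psmul (F : fieldType) (f g : nat -> F) (N : nat) : F :=
  \sum_(k < N.+1) f k * g (N - k)%N.

Definition psdil (F : fieldType) (c : F) (f : nat -> F) (N : nat) : F :=
  c ^+ N * f N.

(* f : nat -> nat -> F is the series \sum_(a, b) f a b * x^a * (Lambda/x)^b;
   since x * (Lambda/x) = Lambda, the monomial x^a * (Lambda/x)^b is
   x^(a-b) * Lambda^b. *)
Definition ps2mul (F : fieldType) (f g : nat -> nat -> F) (a b : nat) : F :=
  \sum_(i < a.+1) \sum_(j < b.+1) f i j * g (a - i)%N (b - j)%N.

Definition in_x (F : fieldType) (s : nat -> F) (c : F) (a b : nat) : F :=
  if b == 0%N then s a * c ^+ a else 0.

Definition in_Lx (F : fieldType) (s : nat -> F) (c : F) (a b : nat) : F :=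
  if a == 0%N then s b * c ^+ b else 0.

Definition in_L (F : fieldType) (s : nat -> F) (c : F) (a b : nat) : F :=
  if a == b then s b * c ^+ b else 0.

(* The operator B on x^i * f(x, Lambda/x), i : int; this product is again
   encoded by f. *)
Definition borel (F : fieldType) (q : F) (i : int) (f : nat -> nat -> F)
    (a b : nat) : F :=
  let k := i + a%:Z - b%:Z in q ^ ((k * (k + 1)) %/ 2)%Z * f a b.

(* The series f with H_S x^i = x^i * f(x, Lambda/x). *)
Definition HS (F : fieldType) (q d1 d2 d3 d4 : F) (i : int) :
    nat -> nat -> F :=
  let phi := phi_coef q in
  let phiV := phiV_coef q in
  let right := ps2mul (in_x phiV (q^-1 * d1 * d2)) (in_Lx phiV (d3 * d4)) in
  let middle :=
    ps2mul (ps2mul (in_L phi 1) (in_L phi (q^-1 * d1 * d2 * d3 * d4)))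
      (ps2mul (ps2mul (in_x phiV (- d1)) (in_x phiV (- d2)))
              (ps2mul (in_Lx phiV (- d3)) (in_Lx phiV (- d4)))) in
  let left := ps2mul (in_x phiV q) (in_Lx phiV 1) in
  ps2mul left (borel q i (ps2mul middle (borel q i right))).

(* r_{i,j}(Lambda), the coefficient of x^j in H_S x^i at d2 = q^-m, d3 = q^-n,
   as a power series in Lambda. *)
Definition r_coef (F : fieldType) (q d1 d4 : F) (m n : nat) (i j : int)
    (N : nat) : F :=
  if j - i + N%:Z is Posz a then HS q d1 (q ^- m) (q ^- n) d4 i a N else 0.

(* f is the expansion at 0 of a rational function P / D which is regular at c
   and takes the value v there. *)
Definition rational_value (F : fieldType) (f : nat -> F) (c v : F) : Prop :=
  exists P D : {poly F},
    [/\ D.[c] != 0, forall N, psmul (fun k => D`_k) f N = P`_N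
      & v = P.[c] / D.[c]].

Lemma rational_value_unique (F : fieldType) (f : nat -> F) (c v w : F) :
  rational_value f c v -> rational_value f c w -> v = w.
Proof.
move=> [P [D [Dc DP ->]]] [P' [D' [Dc' DP' ->]]].
suff E : D' * P = D * P'.
  have := congr1 (fun p : {poly F} => p.[c]) E; rewrite !hornerM => Ec.
  by apply/eqP; rewrite eqr_div // mulrC Ec mulrC.
apply/polyP => k; set T : {poly F} := \poly_(i < k.+1) f i.
have coefT (A : {poly F}) l : (l <= k)%N ->
    (A * T)`_l = psmul (fun i => A`_i) f l.
  move=> lelk; rewrite coefM; apply: eq_bigr => i _.
  by rewrite coef_poly ltnS (leq_trans (leq_subr _ _) lelk).
have -> : (D' * P)`_k = (D' * (D * T))`_k.
  rewrite !coefM; apply: eq_bigr => i _.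
  by rewrite coefT ?leq_subr // DP.
have -> : (D * P')`_k = (D * (D' * T))`_k.
  rewrite !coefM; apply: eq_bigr => i _.
  by rewrite coefT ?leq_subr // DP'.
by rewrite !mulrA [D' * D]mulrC.
Qed.

(* The value at Lambda = c of the rational function with expansion f (a junk
   value if there is no such function, or if it has a pole at c). *)
Definition rational_eval (F : fieldType) (f : nat -> F) (c : F) : F :=
  ClassicalEpsilon.epsilon (inhabits 0) (rational_value f c).

Lemma rational_evalE (F : fieldType) (f : nat -> F) (c v : F) :
  rational_value f c v -> rational_eval f c = v.
Proof.
move=> h; apply: (rational_value_unique _ h).
by apply: ClassicalEpsilon.epsilon_spec; exists v.
Qed.

Definition rtilde (F : fieldType) (q d1 d4 : F) (m n : nat) (i j : int)
    (Q : F) : F :=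
  rational_eval (r_coef q d1 d4 m n i j) (q ^+ (m + 2) / d1 * Q).

(* The indices -n <= i <= m are the integers idx a, a : 'I_(n + m).+1. *)
Definition idx (m n : nat) (a : 'I_(n + m).+1) : int := a%:Z - n%:Z.

Definition normalized_fundamental_solution (F : fieldType)
    (q t d1 d4 : F) (m n : nat) (Q : F)
    (Y : 'I_(n + m).+1 -> 'I_(n + m).+1 -> nat -> F) : Prop :=
  [/\ forall i j : 'I_(n + m).+1, (j < i)%N -> Y i j 0%N = 0,
      forall i : 'I_(n + m).+1, Y i i 0%N = 1
    & forall (k j : 'I_(n + m).+1) (N : nat),
        Y k j N =
        \sum_(i : 'I_(n + m).+1)
          Q ^ (- idx k) * q ^ (- (idx k * (idx k + 1))) * Q ^ idx i *
          psmul (psdil t^-1 (Y k i)) (r_coef q d1 d4 m n (idx i) (idx j)) N].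

(* The formal Laurent series c * Lambda^e * f(Lambda), as the function taking
   N : int to the coefficient of Lambda^N. *)
Definition laurent (F : fieldType) (c : F) (e : int) (f : nat -> F)
    (N : int) : F :=
  if N - e is Posz k then c * f k else 0.

(* v_i(Lambda, Q) = vcoef q d1 d4 m n i Q * Lambda^i. *)
Definition vcoef (F : fieldType) (q d1 d4 : F) (m n : nat) (i : int)
    (Q : F) : F :=
  q ^ (i * (i + 1)) * (d1 / q ^+ (m + 2)) ^ i *
  (qpoch (Q * q ^ (2 + 2 * i)) q (absz (m%:Z - i)) *
   qpoch (d4 * Q * q ^ (1 - n%:Z)) q (absz (n%:Z + i))) /
  (qpoch (d1^-1 * Q * q ^ (2 + i)) q (absz (m%:Z - i)) *
   qpoch (Q * q ^ (1 - n%:Z + i)) q (absz (n%:Z + i))).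

(* Main.v *)
Require Import Defs.
From mathcomp Require Import all_boot all_order all_algebra.
From mathcomp Require Import ring zify.
From Stdlib Require Import FunctionalExtensionality.
Import Order.TTheory GRing.Theory Num.Theory.
Local Open Scope ring_scope.

Set Implicit Arguments.
Unset Strict Implicit.
Unset Printing Implicit Defensive.

(* With d2 = q^-m and d3 = q^-n the operator H_S on the span of x^-n, ..., x^m
   is a scalar multiple of A(q, Lambda) A(-d1, -d4 Lambda), where A(al, be)
   maps x^i to
     q^(i(i+1)/2) x^i (al q^(i-m) x; q)_(m-i) (be q^(-i-n) / x; q)_(n+i);
   this follows from the q-binomial theorem applied to B (x^i / (phi(a x) phi(b
   Lambda / x))).  So r = R / D with R and D polynomial in Lambda.  Row i of a
   matrix is the image of x^i, so matrix products compose from left to right.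
   Write c = d1 / q^(m+2), S for the shift x -> q x, and E_z = diag(z^i).  Up to
   scalars, R(q L) = P(L) R(L) and R(q L) S E_(c q L) = S R(L) E_(c L) P(L) with
   one and the same P(L) = 1 + const L^2 - L Om, where Om is tridiagonal and
   does not depend on L.  As the P(L) commute,
     E_(c y) R(L) E_(c L) R(y) = E_(c L) R(y) E_(c y) R(L)
   holds for L = q^k y, hence identically.  With y = Q / c this says that the
   left-hand side X of the claimed equation satisfies the recursion in Lambda
   which determines Lambda^i Y_(i,.)(Lambda, Q) up to a factor C_i(Q).
   The lowest order terms of X give a factorization of r(y) into a lower
   unitriangular, a diagonal and an upper unitriangular matrix, with the C_i on
   the diagonal up to powers of c.  Inserting it into the second relation for R
   gives C_i(q Q) / C_i(Q), which agrees with the same ratio for v_i; since C_i is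
   a quotient of leading minors of r(y), hence rational in Q, comparing values
   at Q = 0 yields C_i = v_i. *)

(** * Formal power series *)
Section Series.
Variable F : fieldType.
Implicit Types (f g h : nat -> F) (u v w : nat -> nat -> F).

Lemma eq_psmul f f' g g' N : (forall k, (k <= N)%N -> f k = f' k) ->
  (forall k, (k <= N)%N -> g k = g' k) -> psmul f g N = psmul f' g' N.
Proof.
move=> ef eg; apply: eq_bigr => k _.
by rewrite ef ?eg ?leq_subr // -ltnS.
Qed.

Lemma coef_psmul (P R : {poly F}) N :
  (P * R)`_N = psmul (fun k => P`_k) (fun k => R`_k) N.
Proof. by rewrite coefM. Qed.

(** Coefficients of a product up to degree N involve only coefficients of index at most N, so the
    ring laws of [psmul] are inherited from polynomials by truncating at some K > N. *)
Definition trunc K f : {poly F} := \poly_(i < K) f i.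

Lemma truncE K f i : (i < K)%N -> (trunc K f)`_i = f i.
Proof. by move=> lt; rewrite coef_poly lt. Qed.

Lemma psmul_trunc K f g N : (N < K)%N -> psmul f g N = (trunc K f * trunc K g)`_N.
Proof.
move=> lt; rewrite coef_psmul; apply: eq_psmul => k lek; rewrite truncE //;
exact: leq_ltn_trans lt.
Qed.

Lemma psmulC f g : psmul f g = psmul g f.
Proof.
apply: functional_extensionality => N.
by rewrite !(@psmul_trunc N.+1) // mulrC.
Qed.

Lemma psmulA f g h : psmul f (psmul g h) = psmul (psmul f g) h.
Proof.
apply: functional_extensionality => N; pose T := trunc N.+1.
transitivity (T f * (T g * T h))`_N.
  rewrite coef_psmul; apply: eq_psmul => k lek; first by rewrite truncE.
  by apply: psmul_trunc.
rewrite mulrA coef_psmul; apply: eq_psmul => k lek; last by rewrite truncE.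
by symmetry; apply: psmul_trunc.
Qed.

Lemma psmul1 f : psmul (fun k => (k == 0%N)%:R) f = f.
Proof.
apply: functional_extensionality => N; rewrite /psmul big_ord_recl /= subn0 mul1r.
by rewrite big1 ?addr0 // => i _; rewrite mul0r.
Qed.

Lemma eq_ps2mul u u' v v' a b :
  (forall i j, (i <= a)%N -> (j <= b)%N -> u i j = u' i j) ->
  (forall i j, (i <= a)%N -> (j <= b)%N -> v i j = v' i j) ->
  ps2mul u v a b = ps2mul u' v' a b.
Proof.
move=> eu ev; apply: eq_bigr => i _; apply: eq_bigr => j _.
by rewrite eu ?ev ?leq_subr // -ltnS.
Qed.

Lemma coef_ps2mul (P R : {poly {poly F}}) a b :
  (P * R)`_a`_b = ps2mul (fun i j => P`_i`_j) (fun i j => R`_i`_j) a b.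
Proof.
by rewrite coefM coef_sum; apply: eq_bigr => i _; rewrite coefM.
Qed.

(** One bound K serves both variables, so that double series are compared with polynomials over
    [{poly F}]. *)
Definition trunc2 K u : {poly {poly F}} := \poly_(i < K) trunc K (u i).

Lemma trunc2E K u i j : (i < K)%N -> (j < K)%N -> (trunc2 K u)`_i`_j = u i j.
Proof. by move=> lti ltj; rewrite coef_poly lti truncE. Qed.

Lemma ps2mul_trunc K u v a b : (a < K)%N -> (b < K)%N ->
  ps2mul u v a b = (trunc2 K u * trunc2 K v)`_a`_b.
Proof.
move=> lta ltb; rewrite coef_ps2mul; apply: eq_ps2mul => i j lei lej;
by rewrite trunc2E //; [apply: leq_ltn_trans lta | apply: leq_ltn_trans ltb].
Qed.

Lemma funext2 u v : (forall a b, u a b = v a b) -> u = v.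
Proof.
by move=> e; do 2!apply: functional_extensionality => ?; rewrite e.
Qed.

Lemma ps2mulC u v : ps2mul u v = ps2mul v u.
Proof.
apply: funext2 => a b; pose K := (maxn a b).+1.
by rewrite !(@ps2mul_trunc K) 1?mulrC // ltnS leq_max leqnn ?orbT.
Qed.

Lemma ps2mulA u v w : ps2mul u (ps2mul v w) = ps2mul (ps2mul u v) w.
Proof.
apply: funext2 => a b; pose K := (maxn a b).+1; pose T := trunc2 K.
have la i : (i <= a)%N -> (i < K)%N by rewrite ltnS leq_max => ->.
have lb i : (i <= b)%N -> (i < K)%N by rewrite ltnS leq_max => ->; rewrite orbT.
transitivity (T u * (T v * T w))`_a`_b.
  rewrite coef_ps2mul; apply: eq_ps2mul => i j lei lej.
    by rewrite trunc2E //; [exact: la | exact: lb].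
  by apply: ps2mul_trunc; [exact: la | exact: lb].
rewrite mulrA coef_ps2mul; apply: eq_ps2mul => i j lei lej.
  by symmetry; apply: ps2mul_trunc; [exact: la | exact: lb].
by rewrite trunc2E //; [exact: la | exact: lb].
Qed.

Lemma ps2mulCA u v w : ps2mul u (ps2mul v w) = ps2mul v (ps2mul u w).
Proof. by rewrite !ps2mulA [ps2mul u v]ps2mulC. Qed.

Lemma ps2mulACA u v w z :
  ps2mul (ps2mul u v) (ps2mul w z) = ps2mul (ps2mul u w) (ps2mul v z).
Proof. by rewrite -!ps2mulA [ps2mul v _]ps2mulCA. Qed.

(** Variants of [in_x], [in_Lx], [in_L] with the scaling c^k absorbed into the coefficients; factors
    in the same variable then multiply by [psmul]. *)
Definition ser_x f a b : F := if b == 0%N then f a else 0.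
Definition ser_Lx f a b : F := if a == 0%N then f b else 0.
Definition ser_L f a b : F := if a == b then f b else 0.

Lemma ser_xM f g : ps2mul (ser_x f) (ser_x g) = ser_x (psmul f g).
Proof.
apply: funext2 => a b; rewrite /ps2mul /ser_x; case: b => [|b].
  by apply: eq_bigr => i _; rewrite big_ord1.
rewrite big1 // => i _; rewrite big_ord_recl /= mulr0 add0r.
by rewrite big1 // => j _; rewrite mul0r.
Qed.

Lemma ser_LxM f g : ps2mul (ser_Lx f) (ser_Lx g) = ser_Lx (psmul f g).
Proof.
apply: funext2 => a b; rewrite /ps2mul /ser_Lx; case: a => [|a].
  by rewrite big_ord1.
rewrite big_ord_recl /= [X in X + _]big1 ?add0r => [|j _]; last by rewrite mulr0.
by rewrite big1 // => i _; rewrite big1 // => j _; rewrite mul0r.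
Qed.

Lemma ser_xLxM f g a b : ps2mul (ser_x f) (ser_Lx g) a b = f a * g b.
Proof.
rewrite /ps2mul /ser_x /ser_Lx big_ord_recr /= [X in X + _]big1 ?add0r.
  rewrite big_ord_recl /= subnn subn0 big1 ?addr0 // => j _.
  by rewrite mul0r.
move=> i _; rewrite big1 // => j _.
by rewrite subn_eq0 leqNgt ltn_ord mulr0.
Qed.

(** Since Lambda = x * (Lambda/x), a series in Lambda lives on the diagonal and moves both exponents
    by the same amount. *)
Lemma ser_LM_coef f u a b :
  ps2mul (ser_L f) u a b = \sum_(k < (minn a b).+1) f k * u (a - k)%N (b - k)%N.
Proof.
rewrite /ps2mul.
transitivity (\sum_(i < a.+1 | (i < b.+1)%N) f i * u (a - i)%N (b - i)%N).
  rewrite [RHS]big_mkcond; apply: eq_bigr => i _; case: ifP => lt.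
    rewrite (bigD1 (Ordinal lt)) //= /ser_L eqxx big1 ?addr0 // => j ne.
    case: eqP => [e|]; last by rewrite mul0r.
    by case/eqP: ne; apply: val_inj; rewrite /= -e.
  rewrite big1 // => j _; rewrite /ser_L; case: eqP => [e|]; last by rewrite mul0r.
  by rewrite e ltn_ord in lt.
rewrite -(big_mkord (fun i => (i < b.+1)%N) (fun k => f k * u (a - k)%N (b - k)%N)).
rewrite -(big_mkord xpredT (fun k => f k * u (a - k)%N (b - k)%N)).
rewrite !big_mkord.
rewrite (big_ord_widen_cond a.+1 xpredT (fun k => f k * u (a - k)%N (b - k)%N)).
  apply: eq_bigl => i; rewrite /= !ltnS leq_min.
  by rewrite -(ltnS i a) ltn_ord.
by rewrite ltnS geq_minl.
Qed.

Lemma ser_LM f g : ps2mul (ser_L f) (ser_L g) = ser_L (psmul f g).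
Proof.
apply: funext2 => a b; rewrite ser_LM_coef /ser_L.
have [<-|ne] := eqVneq a b.
  by rewrite minnn /psmul; apply: eq_bigr => k _; rewrite eqxx.
rewrite big1 // => k _; case: eqP; last by rewrite mulr0.
by have := ltn_ord k; rewrite ltnS leq_min => /andP[? ?] ?; lia.
Qed.

(** Multiplication by x^k (Lambda/x)^l. *)
Definition shift k l u a b : F :=
  if (k <= a)%N && (l <= b)%N then u (a - k)%N (b - l)%N else 0.

Definition monom k l (a b : nat) : F := ((a == k) && (b == l))%:R.

Lemma monomM k l u : ps2mul (monom k l) u = shift k l u.
Proof.
apply: funext2 => a b; rewrite /ps2mul /shift /monom; case: ifP => [/andP[lek lel]|nle].
  have lek' : (k < a.+1)%N by []. have lel' : (l < b.+1)%N by [].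
  rewrite (bigD1 (Ordinal lek')) //= (bigD1 (Ordinal lel')) //= !eqxx mul1r.
  rewrite [X in _ + X + _]big1 ?addr0 => [|j ne]; last first.
    case: (eqVneq (j : nat) l) => [e|]; last by rewrite andbF mul0r.
    by case/eqP: ne; apply: val_inj.
  rewrite big1 ?addr0 // => i ne; rewrite big1 // => j _.
  case: (eqVneq (i : nat) k) => [e|]; last by rewrite mul0r.
  by case/eqP: ne; apply: val_inj.
rewrite big1 // => i _; rewrite big1 // => j _.
case: eqP => [e|_]; last by rewrite mul0r.
case: eqP => [e'|_]; last by rewrite mul0r.
by move: nle; rewrite -e -e' -ltnS ltn_ord -ltnS ltn_ord.
Qed.

Lemma ps2mul_shift k l u v : ps2mul u (shift k l v) = shift k l (ps2mul u v).
Proof. by rewrite -!monomM ps2mulCA. Qed.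

Lemma ps2mulZ c u v : ps2mul u (fun a b => c * v a b) = fun a b => c * ps2mul u v a b.
Proof.
apply: funext2 => a b; rewrite /ps2mul mulr_sumr; apply: eq_bigr => i _.
by rewrite mulr_sumr; apply: eq_bigr => j _; rewrite mulrCA.
Qed.

Lemma ps2mul_sum (I : finType) u (v : I -> nat -> nat -> F) :
  ps2mul u (fun a b => \sum_i v i a b) = fun a b => \sum_i ps2mul u (v i) a b.
Proof.
apply: funext2 => a b; rewrite /ps2mul [RHS]exchange_big.
apply: eq_bigr => i _ /=; rewrite [RHS]exchange_big.
by apply: eq_bigr => j _ /=; rewrite mulr_sumr.
Qed.

(** Writes multiplication by P(x) R(Lambda/x) as a finite combination of shifts, the form in which
    it can be moved through [borel]. *)
Lemma ps2mul_poly (P R : {poly F}) K L u : (size P <= K)%N -> (size R <= L)%N ->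
  ps2mul (ps2mul (ser_x (fun k => P`_k)) (ser_Lx (fun l => R`_l))) u =
  fun a b => \sum_(k < K) \sum_(l < L) (P`_k * R`_l) * shift k l u a b.
Proof.
move=> sP sR.
have -> : ps2mul (ser_x (fun k => P`_k)) (ser_Lx (fun l => R`_l)) =
    fun a b => \sum_(k < K) \sum_(l < L) (P`_k * R`_l) * monom k l a b.
  apply: funext2 => a b; rewrite ser_xLxM /monom.
  have co (A : {poly F}) (c J : nat) : (size A <= J)%N ->
      \sum_(k < J) A`_k * (c == k)%:R = A`_c.
    move=> sA; have [lt|le] := ltnP c J.
      rewrite (bigD1 (Ordinal lt)) //= eqxx mulr1 big1 ?addr0 // => k ne.
      case: eqP => [e|]; last by rewrite mulr0.
      by case/eqP: ne; apply: val_inj.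
    rewrite nth_default ?(leq_trans sA) // big1 // => k _.
    case: eqP => [e|]; last by rewrite mulr0.
    by move: (ltn_ord k); rewrite -e ltnNge le.
  rewrite -{1}(co P a K) // -{1}(co R b L) // mulr_suml; apply: eq_bigr => k _.
  rewrite mulr_sumr; apply: eq_bigr => l _.
  by rewrite mulrACA -natrM mulnb.
rewrite ps2mulC ps2mul_sum; apply: funext2 => a b; apply: eq_bigr => k _.
rewrite (ps2mul_sum u (fun l : 'I_L => fun a b => P`_k * R`_l * monom k l a b)).
apply: eq_bigr => l _.
by rewrite ps2mulZ ps2mulC monomM.
Qed.

End Series.

(** * Borel exponents and q-series identities *)

Definition triang (i : int) : int := ((i * (i + 1)) %/ 2)%Z.

(** The doubled form removes the integer division, so that identities between exponents become ring
    identities. *)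
Lemma triang2 (i : int) : triang i * 2 = i * (i + 1).
Proof.
apply: divzK.
have [j []->] : exists j : int, i = 2 * j \/ i = 2 * j + 1.
- by exists (i %/ 2)%Z; have := divz_eq i 2; have := modz_ge0 i (isT : 2 != 0 :> int);
     have := ltz_pmod i (isT : 0 < 2 :> int); lia.
- by apply/dvdzP; exists (j * (2 * j + 1)); ring.
- by apply/dvdzP; exists ((2 * j + 1) * (j + 1)); ring.
Qed.

Lemma bin2z (k : nat) : ('C(k, 2))%:Z * 2 = k%:Z * (k%:Z - 1).
Proof.
by elim: k => // k; rewrite binS bin1; nia.
Qed.

Section QSeries.
Variables (F : fieldType) (q : F).
Hypothesis q0 : q != 0.
Hypothesis hq : forall l : nat, (0 < l)%N -> q ^+ l != 1.

(** The polynomial (c X; q)_r; [phis c] and [phiVs c] are the series phi(c z) and 1 / phi(c z). *)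
Definition pochX (c : F) (r : nat) : {poly F} :=
  \prod_(s < r) (1 - (c * q ^+ s)%:P * 'X).

Definition phis (c : F) (k : nat) : F := phi_coef q k * c ^+ k.
Definition phiVs (c : F) (k : nat) : F := phiV_coef q k * c ^+ k.

Lemma pochXSr c r : pochX c r.+1 = (1 - (c * q ^+ r)%:P * 'X) * pochX c r.
Proof. by rewrite /pochX big_ord_recr /= [LHS]mulrC. Qed.

Lemma size_pochX c r : (size (pochX c r) <= r.+1)%N.
Proof.
clear q0 hq.
elim: r => [|r IH]; first by rewrite /pochX big_ord0 size_poly1.
rewrite pochXSr; apply: leq_trans (size_polyMleq _ _) _.
have Rscal2 : (size (1 - (c * q ^+ r)%:P * 'X)%R <= 2)%N.
  rewrite (leq_trans (size_polyD _ _)) // geq_max size_poly1 size_polyN /=.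
  by rewrite mul_polyC (leq_trans (size_scale_leq _ _)) // size_polyX.
by move: Rscal2 IH; move: (size _) (size _) => u v; lia.
Qed.

Lemma horner_pochX c r x : (pochX c r).[x] = \prod_(s < r) (1 - c * q ^+ s * x).
Proof. by rewrite horner_prod; apply: eq_bigr => s _; rewrite !hornerE. Qed.

Lemma psmul_coefM (P R : {poly F}) f :
  psmul (fun k => (P * R)`_k) f = psmul (fun k => P`_k) (psmul (fun k => R`_k) f).
Proof.
by rewrite psmulA; congr psmul; apply: functional_extensionality => k; rewrite coef_psmul.
Qed.

(** Coefficient form of (1 - c z) / phi(c z) = 1 / phi(q c z). *)
Lemma phiVsS c k : phiVs c k.+1 * (1 - q ^+ k.+1) = c * phiVs c k.
Proof.
have h1 := qpoch_neq0 k hq; have h2 : 1 - q ^+ k.+1 != 0.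
  by rewrite subr_eq0 eq_sym hq.
rewrite /phiVs /phiV_coef [qpoch q q k.+1]big_ord_recr /= -exprS -/(qpoch q q k).
rewrite [c ^+ _]exprS; move: (q ^+ k.+1) (qpoch q q k) h1 h2 => z p h1 h2.
by field; rewrite h1 h2.
Qed.

Lemma psmul_phiVs c r : psmul (fun k => (pochX c r)`_k) (phiVs c) = phiVs (c * q ^+ r).
Proof.
elim: r => [|r IH].
  rewrite expr0 mulr1 -[RHS]psmul1; congr psmul.
  by apply: functional_extensionality => k; rewrite /pochX big_ord0 coef1.
rewrite pochXSr psmul_coefM IH; set b := c * q ^+ r.
rewrite exprSr mulrA -/b; apply: functional_extensionality => -[|k].
  by rewrite /psmul big_ord1 coefB coef1 coefMX mulr1n subr0 mul1r /phiVs !expr0.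
rewrite /psmul 2!big_ord_recl big1 => [|i _]; last first.
  by rewrite coefB coef1 coefCM coefX /= mulr0 subr0 mul0r.
rewrite /= addr0 !coefB !coef1 !coefCM !coefX /= subn0 subn1 /=.
rewrite mulr0 subr0 mul1r sub0r mulr1 mulNr -phiVsS.
by rewrite /phiVs [(b * q) ^+ _]exprMn; ring.
Qed.

Lemma psmul_phis_phiVs1 c : psmul (phis c) (phiVs c) = fun k => (k == 0%N)%:R.
Proof.
apply: functional_extensionality => N.
transitivity (c ^+ N * (N == 0%N)%:R); last by case: N => [|N]; rewrite ?mul1r ?mulr0.
rewrite -(phi_coefV N hq) mulr_sumr; apply: eq_bigr => k _.
have -> : c ^+ N = c ^+ k * c ^+ (N - k) by rewrite -exprD subnKC // -ltnS.
by rewrite /phis /phiVs; ring.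
Qed.

Lemma psmul_phis_phiVs c r :
  psmul (phis c) (phiVs (c * q ^+ r)) = fun k => (pochX c r)`_k.
Proof.
by rewrite -psmul_phiVs psmulC -psmulA [psmul _ (phis c)]psmulC psmul_phis_phiVs1
   psmulC psmul1.
Qed.

Lemma psmul_phis c r : psmul (fun k => (pochX c r)`_k) (phis (c * q ^+ r)) = phis c.
Proof.
rewrite -psmul_phis_phiVs -psmulA [psmul (phiVs _) _]psmulC psmul_phis_phiVs1.
by rewrite psmulC psmul1.
Qed.

Lemma coef_pochX1 l s :
  (pochX 1 l)`_s = phi_coef q s * \prod_(u < s) (1 - q ^+ (l - u)).
Proof.
rewrite -qpoch_coef //; suff -> : pochX 1 l = \prod_(k < l) (1 - (q ^+ k)%:P * 'X) by [].
by apply: eq_bigr => k _; rewrite mul1r.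
Qed.

Lemma qpoch_split l s : (s <= l)%N ->
  \prod_(u < s) (1 - q ^+ (l - u)) * qpoch q q (l - s) = qpoch q q l.
Proof.
clear q0 hq.
elim: s => [|s IH] les; first by rewrite big_ord0 mul1r subn0.
rewrite big_ord_recr /= -mulrA -(IH (ltnW les)); congr (_ * _).
rewrite subnS; case e: (l - s)%N => [|k]; first by lia.
by rewrite /= /qpoch big_ord_recr /= -exprS mulrC.
Qed.

(** Compares the coefficients of z^k in (z; q)_l / phi(z) = 1 / phi(q^l z). *)
Lemma phi_phiV_phiV k l :
  \sum_(s < (minn k l).+1) phi_coef q s * (phiV_coef q (k - s) * phiV_coef q (l - s)) =
  q ^+ (k * l) * (phiV_coef q k * phiV_coef q l).
Proof.
have := congr1 (fun f => f k) (psmul_phiVs 1 l).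
rewrite /phiVs mul1r -exprM [(l * k)%N]mulnC mulrC => e.
rewrite mulrA -e /psmul mulr_suml.
rewrite (big_ord_widen_cond k.+1 xpredT
  (fun s => phi_coef q s * (phiV_coef q (k - s) * phiV_coef q (l - s)))) ?ltnS ?geq_minl //.
rewrite big_mkcond; apply: eq_bigr => s _; rewrite /= expr1n mulr1 coef_pochX1.
rewrite ltnS leq_min -ltnS ltn_ord /=; have [les|lts] := leqP s l.
  rewrite /phiV_coef -(qpoch_split les).
  have h1 := qpoch_neq0 (l - s) hq; have := qpoch_neq0 l hq.
  rewrite -(qpoch_split les) mulf_eq0 negb_or => /andP[h2 _].
  by have h3 := qpoch_neq0 (k - s) hq; field; rewrite h1 h2 h3.
(* For s > l the factor u = l of the product is 1 - q^0 = 0, which matches the summation bound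
   [minn k l]. *)
rewrite [X in _ = _ * X * _ * _](bigD1 (Ordinal lts)) //=.
by rewrite subnn expr0 subrr !(mul0r, mulr0).
Qed.

(** After multiplication by phi(a b Lambda), B turns 1 / (phi(a x) phi(b Lambda/x)) into a product
    of two phi's. By [phi_phiV_phiV] the coefficient of x^k (Lambda/x)^l gains q^(k l), and the
    Borel exponent at i + k - l increased by k l splits into a part in k and a part in l. *)
Lemma borel_phiV (i : int) a b :
  ps2mul (ser_L (phis (a * b))) (borel q i (ps2mul (ser_x (phiVs a)) (ser_Lx (phiVs b)))) =
  fun k l => q ^ triang i *
    ps2mul (ser_x (phis (- (q ^ (i + 1) * a)))) (ser_Lx (phis (- (q ^ (- i) * b)))) k l.
Proof.
apply: funext2 => k l; rewrite ser_xLxM ser_LM_coef.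
transitivity (q ^ triang (i + k%:Z - l%:Z) * a ^+ k * b ^+ l *
  \sum_(s < (minn k l).+1) phi_coef q s * (phiV_coef q (k - s) * phiV_coef q (l - s))).
  rewrite mulr_sumr; apply: eq_bigr => s _.
  have : (s <= k)%N && (s <= l)%N by rewrite -leq_min -ltnS.
  case/andP=> sk sl; rewrite /borel ser_xLxM /phis /phiVs.
  have -> : i + (k - s)%N%:Z - (l - s)%N%:Z = i + k%:Z - l%:Z by lia.
  have -> : a ^+ k = a ^+ s * a ^+ (k - s) by rewrite -exprD subnKC.
  have -> : b ^+ l = b ^+ s * b ^+ (l - s) by rewrite -exprD subnKC.
  by rewrite -/(triang _) exprMn; ring.
rewrite phi_phiV_phiV /phis /phi_coef -/(phiV_coef q k) -/(phiV_coef q l).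
have qX (j : int) (p : nat) : (q ^ j) ^+ p = q ^ (j * p%:Z) by rewrite exprnP exprz_exp.
rewrite ![(- (q ^ _ * _)) ^+ _]exprNn !exprMn !qX.
have e : q ^ triang (i + k%:Z - l%:Z) * q ^+ (k * l) =
    q ^ triang i * q ^+ 'C(k, 2) * q ^ ((i + 1) * k%:Z) * (q ^+ 'C(l, 2) * q ^ (- i * l%:Z)).
  rewrite (exprnP q (k * l)) (exprnP q 'C(k, 2)) (exprnP q 'C(l, 2)).
  rewrite -!expfzDr //; congr (q ^ _).
  have t1 := triang2 i; have t2 := triang2 (i + k%:Z - l%:Z).
  have t3 := bin2z k; have t4 := bin2z l.
  apply: (@mulIf _ 2) => //.
  by rewrite !mulrDl t1 t2 t3 t4 PoszM; ring.
have Rscal1 : (-1) ^+ k * (-1) ^+ k = 1 :> F by rewrite -exprMn mulrNN mulr1 expr1n.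
have Rscal2 : (-1) ^+ l * (-1) ^+ l = 1 :> F by rewrite -exprMn mulrNN mulr1 expr1n.
transitivity ((q ^ triang (i + k%:Z - l%:Z) * q ^+ (k * l)) * (a ^+ k * b ^+ l *
  (phiV_coef q k * phiV_coef q l)) * ((-1) ^+ k * (-1) ^+ k) * ((-1) ^+ l * (-1) ^+ l)).
  by rewrite Rscal1 Rscal2; ring.
by rewrite e /phiV_coef; ring.
Qed.

(** A series in Lambda leaves the power of x unchanged, and the Borel factor depends on nothing
    else. *)
Lemma borel_ser_L i f u : borel q i (ps2mul (ser_L f) u) = ps2mul (ser_L f) (borel q i u).
Proof.
clear q0 hq.
apply: funext2 => a b; rewrite /borel !ser_LM_coef mulr_sumr; apply: eq_bigr => k _.
have : (k <= a)%N && (k <= b)%N by rewrite -leq_min -ltnS.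
case/andP=> ka kb.
have -> : i + (a - k)%N%:Z - (b - k)%N%:Z = i + a%:Z - b%:Z by lia.
by rewrite mulrCA.
Qed.

Lemma borel_shift (i : int) k l u :
  borel q i (shift k l u) = shift k l (borel q (i + k%:Z - l%:Z) u).
Proof.
clear q0 hq.
apply: funext2 => a b; rewrite /borel /shift; case: ifP => [/andP[ka lb]|_]; last by rewrite mulr0.
by congr (q ^ ((_ * (_ + _)) %/ _)%Z * _); lia.
Qed.

End QSeries.

(** * The operator H_S on Laurent polynomials *)
Section HS.
Variables (F : fieldType) (q : F).
Hypothesis q0 : q != 0.
Hypothesis hq : forall l : nat, (0 < l)%N -> q ^+ l != 1.

Definition xpoly (c : F) (k : nat) : {poly F} := pochX q (c * q ^- k) k.

(** The quotient phi(d x) / phi(c x) terminates when d = c q^-k; this is how d2 = q^-m and d3 = q^-n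
    produce polynomials. *)
Lemma psmul_xpoly c d k : d = c * q ^- k ->
  psmul (phis q d) (phiVs q c) = fun j => (xpoly c k)`_j.
Proof.
move=> ->; rewrite -(psmul_phis_phiVs hq); congr (psmul _ (phiVs q _)).
by rewrite mulfVK // expf_neq0.
Qed.

Variables (d1 d4 : F) (m n : nat).
Local Notation M := (n + m)%N.

(** [borel_phiV] applies twice. The first time it uses the factor phi(q^-1 d1 d2 d3 d4 Lambda), and
    its output over phi(-d1 x) phi(-d4 Lambda/x) is the polynomial P(x) R(Lambda/x). The second time
    it requires phi(q^-M Lambda) while H_S offers phi(Lambda); the factor (q^-M Lambda; q)_M makes
    up the difference and becomes the denominator of r. *)
Lemma HS_expand (a : nat) : (a <= M)%N ->
  let i := a%:Z - n%:Z in
  let P := xpoly (- d1) (M - a) in let R := xpoly (- d4) a in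
  ps2mul (ser_L (fun k => (pochX q (q ^- M) M)`_k)) (HS q d1 (q ^- m) (q ^- n) d4 i) =
  fun A N => \sum_(k < (M - a).+1) \sum_(l < a.+1)
    (q ^ triang i * (P`_k * R`_l)) *
    shift k l (fun A' N' => q ^ triang (i + k%:Z - l%:Z) *
      ps2mul (ser_x (fun j => (xpoly q (M - (a + k - l)))`_j))
             (ser_Lx (fun j => (xpoly 1 (a + k - l))`_j)) A' N') A N.
Proof.
move=> leaM i P R.
pose a0 := q^-1 * d1 * q ^- m; pose b0 := q ^- n * d4.
pose g := ps2mul (ser_L (phis q 1))
  (ps2mul (ser_x (phiVs q (- q ^- m))) (ser_Lx (phiVs q (- q ^- n)))).
pose E := ps2mul (ser_x (fun k => P`_k)) (ser_Lx (fun l => R`_l)).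
have qa k : q ^+ k != 0 by rewrite expf_neq0.
(* The inner Borel operator: what remains besides P(x) R(Lambda/x) is g, made of phi(Lambda) and the
   factors containing d2 and d3. *)
have hmid : ps2mul
   (ps2mul (ps2mul (ser_L (phis q 1)) (ser_L (phis q (q^-1 * d1 * q ^- m * q ^- n * d4))))
     (ps2mul (ps2mul (ser_x (phiVs q (- d1))) (ser_x (phiVs q (- q ^- m))))
             (ps2mul (ser_Lx (phiVs q (- q ^- n))) (ser_Lx (phiVs q (- d4))))))
   (borel q i (ps2mul (ser_x (phiVs q a0)) (ser_Lx (phiVs q b0)))) =
   fun A N => q ^ triang i * ps2mul E g A N.
  have -> : q^-1 * d1 * q ^- m * q ^- n * d4 = a0 * b0 by rewrite /a0 /b0; ring.
  set X1 := ser_x _; set X2 := ser_x _; set X3 := ser_Lx _; set X4 := ser_Lx _.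
  set L1 := ser_L _; set L2 := ser_L _; set br := borel _ _ _.
  transitivity (ps2mul L1 (ps2mul (ps2mul X2 X3)
     (ps2mul (ps2mul X1 X4) (ps2mul L2 br)))).
    rewrite -!ps2mulA; congr (ps2mul L1 _).
    rewrite (ps2mulCA L2 X1) (ps2mulCA L2 X2) (ps2mulCA L2 X3) (ps2mulCA L2 X4).
    by rewrite (ps2mulCA X1 X2) (ps2mulCA X1 X3).
  rewrite (borel_phiV q0 hq) !ps2mulZ; apply: funext2 => A N; congr (_ * _).
  suff -> : E = ps2mul (ps2mul X1 X4)
    (ps2mul (ser_x (phis q (- (q ^ (i + 1) * a0)))) (ser_Lx (phis q (- (q ^ (- i) * b0))))).
    by rewrite /g -/L1 -/X2 -/X3 [in RHS]ps2mulC -!ps2mulA.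
  rewrite ps2mulACA ser_xM ser_LxM psmulC [psmul (phiVs q (- d4)) _]psmulC /E.
  rewrite (@psmul_xpoly (- d1) _ (M - a)) ?(@psmul_xpoly (- d4) _ a) //.
    rewrite /b0 /i mulrA mulNr; congr (- _); rewrite mulrC; congr (_ * _).
    rewrite [q ^- n]exprnN [q ^- a]exprnN -expfzDr //; congr (q ^ _); lia.
  rewrite /a0 mulNr; congr (- _).
  transitivity (d1 * (q ^ (i + 1) * q ^ (-1) * q ^ (- m%:Z))).
    by rewrite -exprnN exprN1; ring.
  by rewrite -!expfzDr // [q ^- _]exprnN; congr (_ * q ^ _); rewrite /i; lia.
rewrite /HS -/(phis q) -/(phiVs q).
rewrite [X in ps2mul _ X = _](_ : _ = ps2mul (ps2mul (ser_x (phiVs q q)) (ser_Lx (phiVs q 1)))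
  (borel q i (fun A N => q ^ triang i * ps2mul E g A N))); last first.
  by rewrite -hmid.
rewrite /E (ps2mul_poly g (size_pochX _ _ _) (size_pochX _ _ _)).
set left := ps2mul (ser_x _) _; set D := ser_L _.
have -> : borel q i (fun A N => q ^ triang i *
    \sum_(k < (M - a).+1) \sum_(l < a.+1) P`_k * R`_l * shift k l g A N) =
  fun A N => \sum_(k < (M - a).+1) \sum_(l < a.+1)
    (q ^ triang i * (P`_k * R`_l)) * shift k l (borel q (i + k%:Z - l%:Z) g) A N.
  apply: funext2 => A N; rewrite {1}/borel mulrCA mulr_sumr mulr_sumr.
  apply: eq_bigr => k _; rewrite mulr_sumr mulr_sumr; apply: eq_bigr => l _.
  by rewrite -borel_shift /borel [RHS]mulrACA mulrA.
rewrite ps2mulA (ps2mul_sum (ps2mul D left) (fun k : 'I_(M - a).+1 => fun A N =>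
  \sum_(l < a.+1) (q ^ triang i * (P`_k * R`_l)) * shift k l (borel q (i + k%:Z - l%:Z) g) A N)).
apply: funext2 => A N; apply: eq_bigr => k _.
rewrite (ps2mul_sum (ps2mul D left) (fun l : 'I_a.+1 => fun A N =>
  (q ^ triang i * (P`_k * R`_l)) * shift k l (borel q (i + k%:Z - l%:Z) g) A N)).
apply: eq_bigr => l _; rewrite ps2mulZ; congr (_ * _).
rewrite ps2mul_shift; congr (shift k l _ A N).
have lek : (k <= M - a)%N by rewrite -ltnS.
have lel : (l <= a)%N by rewrite -ltnS.
(* The term x^k (Lambda/x)^l of P R sends x^i to a multiple of x^j; c is the index of the exponent
   j. *)
set j := i + k%:Z - l%:Z; set c := (a + k - l)%N.
have hj : j = c%:Z - n%:Z by rewrite /j /i /c; lia.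
rewrite /g borel_ser_L -ps2mulA [ps2mul left _]ps2mulCA ps2mulA /D ser_LM.
(* This is (q^-M Lambda; q)_M phi(Lambda) = phi(q^-M Lambda), with q^-M = (-d2) (-d3). *)
have -> : psmul (fun k => (pochX q (q ^- M) M)`_k) (phis q 1) =
    phis q (- q ^- m * - q ^- n).
  have -> : - q ^- m * - q ^- n = q ^- M by rewrite mulrNN exprD mulrC invfM.
  by rewrite -[RHS](psmul_phis hq _ M) mulVf.
rewrite ps2mulCA (borel_phiV q0 hq) ps2mulZ; apply: funext2 => A' N'; congr (_ * _).
rewrite /left ps2mulACA ser_xM ser_LxM psmulC [psmul (phiVs q 1) _]psmulC.
rewrite (@psmul_xpoly q _ (M - c)) ?(@psmul_xpoly 1 _ c) //.
  rewrite mul1r mulrN opprK [q ^- n]exprnN [q ^- c]exprnN -expfzDr //.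
  by congr (q ^ _); rewrite hj; lia.
rewrite mulrN opprK [q ^- m]exprnN [q ^- (M - c)]exprnN -expfzDr //.
rewrite -[q in RHS]expr1z -expfzDr //; congr (q ^ _).
by rewrite hj /c; lia.
Qed.

End HS.

(** * The polynomial matrix R and its denominator *)

Section Rmatrix.
Variables (F : fieldType) (q : F) (m n : nat).
Local Notation M := (n + m)%N.

(* Bentry al be a c is the coefficient of x^(c - n) in A(al, be Lambda) x^(a - n),
   as a polynomial in Lambda. *)
Definition Bentry (al be : F) (a c : nat) : {poly F} :=
  \poly_(l < a.+1) (if (a <= c + l)%N then
    q ^ triang (a%:Z - n%:Z) * ((xpoly q al (M - a))`_(c + l - a) * (xpoly q be a)`_l) else 0).

Definition Bmx (al be : F) : 'M[{poly F}]_M.+1 := \matrix_(a, c) Bentry al be a c.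

(** The numerator of r over the common denominator (q^-M Lambda; q)_M; the left factor is the one
    applied first. *)
Definition Rmx (d1 d4 : F) : 'M[{poly F}]_M.+1 := Bmx (- d1) (- d4) *m Bmx q 1.

Lemma coef_Bentry al be a c l :
  (Bentry al be a c)`_l = if (a <= c + l)%N then
    q ^ triang (a%:Z - n%:Z) * ((xpoly q al (M - a))`_(c + l - a) * (xpoly q be a)`_l) else 0.
Proof.
rewrite coef_poly; case: ltnP => // lt; case: ifP => // _.
by rewrite [(xpoly q be a)`_l]nth_default ?mulr0 // (leq_trans (size_pochX _ _ _)).
Qed.

(** The substitution is c = a + k - l: the guard says that k is nonnegative, and l <= a keeps the
    natural subtraction exact. *)
Lemma sum_reindex (P : {poly F}) a l (G : nat -> F) : (l <= a)%N -> (a <= M)%N ->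
  (size P <= (M - a).+1)%N ->
  \sum_(c < M.+1) (if (a <= c + l)%N then P`_(c + l - a) * G c else 0) =
  \sum_(k < (M - a).+1) P`_k * G (a + k - l)%N.
Proof.
move=> la aM sP.
rewrite -(big_mkord xpredT (fun c => if (a <= c + l)%N then P`_(c + l - a) * G c else 0)).
rewrite (@big_cat_nat _ _ _ (a - l)) //=; last by lia.
rewrite big_nat_cond big1 ?add0r => [|c]; last first.
  by rewrite andbT => /andP[_ lt]; rewrite ifF //; apply/negbTE; lia.
rewrite -{1}(add0n (a - l)%N) big_addn (@big_cat_nat _ _ _ (M - a).+1) //=; last by lia.
rewrite big_mkord [X in _ + X]big_nat_cond [X in _ + X]big1 ?addr0 => [|k]; last first.
  rewrite andbT => /andP[le _]; case: ifP => // _.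
  by rewrite nth_default ?mul0r // (leq_trans sP) //; lia.
apply: eq_bigr => k _; rewrite ifT; last by lia.
by congr (P`_ _ * G _); lia.
Qed.

(** Row a, read as a function of x, is x^n times the image of x^(a-n) under A(al, be L). Matrix
    identities can thus be checked as identities between functions of x. *)
Lemma row_Bentry al be a (L x : F) : (a <= M)%N -> x != 0 ->
  \sum_(c < M.+1) (Bentry al be a c).[L] * x ^+ c =
  q ^ triang (a%:Z - n%:Z) * (xpoly q al (M - a)).[x] * (x ^+ a * (xpoly q be a).[L / x]).
Proof.
move=> aM x0; set P := xpoly q al _; set R := xpoly q be a.
transitivity (\sum_(l < a.+1) (q ^ triang (a%:Z - n%:Z) * (R`_l * L ^+ l)) *
  \sum_(c < M.+1) (if (a <= c + l)%N then P`_(c + l - a) * x ^+ c else 0)).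
  under eq_bigr => c _ do rewrite horner_poly mulr_suml.
  rewrite exchange_big; apply: eq_bigr => l _; rewrite mulr_sumr; apply: eq_bigr => c _ /=.
  by case: ifP => _; rewrite ?mul0r ?mulr0 // -/P -/R; ring.
transitivity (\sum_(l < a.+1) (q ^ triang (a%:Z - n%:Z) * (R`_l * L ^+ l)) *
  \sum_(k < (M - a).+1) P`_k * x ^+ (a + k - l)).
  apply: eq_bigr => l _; congr (_ * _).
  by apply: (sum_reindex (fun c => x ^+ c)); rewrite ?size_pochX // -ltnS.
rewrite (horner_coef_wide x (size_pochX q _ _)).
rewrite (horner_coef_wide (L / x) (size_pochX q _ _)) !mulr_sumr.
apply: eq_bigr => l _; rewrite mulr_sumr mulr_suml.
apply: eq_bigr => k _; rewrite -/P -/R exprMn exprVn.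
have la : (l <= a)%N by rewrite -ltnS.
have -> : x ^+ (a + k - l) = x ^+ k * x ^+ a / x ^+ l.
  by rewrite expfB_cond ?(negPf x0) ?exprD 1?[x ^+ a * _]mulrC //=; lia.
by ring.
Qed.

Hypothesis q0 : q != 0.
Hypothesis hq : forall l : nat, (0 < l)%N -> q ^+ l != 1.

(** Shows that r is rational, by reading off the coefficient of x^(b-n) in [HS_expand]. *)
Lemma r_coefE (d1 d4 : F) (a b : 'I_M.+1) N :
  psmul (fun k => (pochX q (q ^- M) M)`_k) (r_coef q d1 d4 m n (idx a) (idx b)) N =
  (Rmx d1 d4 a b)`_N.
Proof.
have leaM : (a <= M)%N by rewrite -ltnS.
set P := xpoly q (- d1) (M - a); set R := xpoly q (- d4) a.
have eR : (Rmx d1 d4 a b)`_N = \sum_(l < N.+1) if (l <= a)%N then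
    \sum_(k < (M - a).+1) q ^ triang (idx a) * (P`_k * R`_l) *
       (Bentry q 1 (a + k - l) b)`_(N - l) else 0.
  rewrite mxE coef_sum.
  under eq_bigr => c _ do rewrite !mxE coefM.
  rewrite exchange_big; apply: eq_bigr => l _ /=.
  case: ifP => la; last first.
    rewrite big1 // => c _; rewrite (coef_Bentry (- d1)) -/R; case: ifP => _; last by rewrite mul0r.
    by rewrite [R`_l]nth_default ?mulr0 ?mul0r // (leq_trans (size_pochX _ _ _)) // ltnNge la.
  transitivity (q ^ triang (idx a) * R`_l * \sum_(c < M.+1)
    if (a <= c + l)%N then P`_(c + l - a) * (Bentry q 1 c b)`_(N - l) else 0).
    rewrite mulr_sumr; apply: eq_bigr => c _; rewrite (coef_Bentry (- d1)) -/P -/R.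
    by case: ifP => _; rewrite ?mul0r ?mulr0 // /idx; ring.
  rewrite (sum_reindex (fun c => (Bentry q 1 c b)`_(N - l))) ?size_pochX //.
  by rewrite mulr_sumr; apply: eq_bigr => k _; ring.
(* If b + N < a, the monomial in question would contain a negative power of x beside (Lambda/x)^N,
   and both sides vanish; otherwise A is that power of x. *)
rewrite eR; have [le|lt] := leqP a (b + N); last first.
  rewrite [LHS]big1 => [|k _]; last first.
    rewrite /r_coef /idx; case e: (_ - _ + _) => [A|A]; last by rewrite mulr0.
    by exfalso; have := ltn_ord k; lia.
  rewrite big1 // => l _; case: ifP => // la; rewrite big1 // => k _.
  by rewrite coef_Bentry ifF ?mulr0 //; apply/negbTE; have := ltn_ord l; lia.
pose A := (b + N - a)%N.
transitivity (ps2mul (ser_L (fun k => (pochX q (q ^- M) M)`_k))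
    (HS q d1 (q ^- m) (q ^- n) d4 (idx a)) A N).
  rewrite ser_LM_coef /psmul.
  rewrite (big_ord_widen_cond N.+1 xpredT (fun k => (pochX q (q ^- M) M)`_k *
    HS q d1 (q ^- m) (q ^- n) d4 (idx a) (A - k)%N (N - k)%N)) ?ltnS ?geq_minr //.
  rewrite [RHS]big_mkcond; apply: eq_bigr => k _ /=.
  have kN : (k <= N)%N by rewrite -ltnS.
  rewrite ltnS leq_min kN andbT /r_coef; case: ifP => kA.
    have -> : idx b - idx a + (N - k)%N%:Z = Posz (A - k) by rewrite /idx /A; lia.
    by [].
  case e: (_ - _ + _) => [z|z]; last by rewrite mulr0.
  by exfalso; move: e kA; rewrite /idx /A; lia.
rewrite /idx (HS_expand q0 hq) // exchange_big /=.
transitivity (\sum_(l < a.+1 | (l < N.+1)%N) \sum_(k < (M - a).+1)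
  q ^ triang (idx a) * (P`_k * R`_l) * (Bentry q 1 (a + k - l) b)`_(N - l)).
  rewrite [RHS]big_mkcond; apply: eq_bigr => l _ /=.
  have la : (l <= a)%N by rewrite -ltnS.
  case: ifP => lN; last first.
    by rewrite big1 // => k _; rewrite /shift -(ltnS l) lN andbF mulr0.
  apply: eq_bigr => k _; rewrite -/P -/R; congr (_ * _).
  rewrite /shift -(ltnS l) lN andbT coef_Bentry.
  have kM : (k <= M - a)%N by rewrite -ltnS.
  rewrite ltnS in lN.
  rewrite (_ : (a + k - l <= b + (N - l))%N = (k <= A)%N); last by rewrite /A; lia.
  case: ifP => // kA; rewrite ser_xLxM.
  have -> : a%:Z - n%:Z + k%:Z - l%:Z = (a + k - l)%N%:Z - n%:Z by lia.
  by rewrite (_ : (b + (N - l) - (a + k - l) = A - k)%N) //; rewrite /A; lia.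
pose G l := \sum_(k < (M - a).+1)
  q ^ triang (idx a) * (P`_k * R`_l) * (Bentry q 1 (a + k - l) b)`_(N - l).
rewrite -/(G _) -[RHS]big_mkcond /=.
rewrite -(big_mkord (fun l => (l < N.+1)%N) G) -(big_mkord (fun l => (l <= a)%N) G).
rewrite (big_nat_widen 0 a.+1 (maxn a N).+1) ?ltnS ?leq_maxl //.
rewrite (big_nat_widen 0 N.+1 (maxn a N).+1) ?ltnS ?leq_maxr //.
by apply: eq_bigl => l; rewrite !ltnS andbC.
Qed.

End Rmatrix.

(** * The commuting shift relations of R *)
Section Shift.
Variables (F : fieldType) (q : F).
Hypothesis q0 : q != 0.

(** This is (q^-k z; q)_k, the value of [xpoly q al k] at x for z = al x. *)
Definition Wprod (k : nat) (z : F) : F := \prod_(s < k) (1 - z / q ^+ s.+1).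

Lemma Wprod0 z : Wprod 0 z = 1.
Proof. by rewrite /Wprod big_ord0. Qed.

Lemma WprodS k z : Wprod k.+1 z = Wprod k z * (1 - z / q ^+ k.+1).
Proof. by rewrite /Wprod big_ord_recr. Qed.

Lemma Wprod_shift k z : Wprod k.+1 (q * z) = (1 - z) * Wprod k z.
Proof.
rewrite /Wprod big_ord_recl /= expr1; congr (_ * _).
  by rewrite mulrC mulKf.
apply: eq_bigr => s _; rewrite /bump /= add1n exprS.
by rewrite -mulf_div divff // mul1r.
Qed.

Lemma Wprod_shiftl k z : (1 - z) * Wprod k z = Wprod k (q * z) * (1 - z / q ^+ k).
Proof.
by rewrite -Wprod_shift WprodS exprS -mulf_div divff // mul1r.
Qed.

Lemma horner_xpoly al k x : (xpoly q al k).[x] = Wprod k (al * x).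
Proof.
rewrite /xpoly horner_pochX /Wprod (reindex_inj rev_ord_inj) /=.
apply: eq_bigr => s _; rewrite -[al * _ * _]mulrA.
have -> : q ^- k * q ^+ (k - s.+1) = (q ^+ s.+1)^-1.
  have -> : q ^+ k = q ^+ (k - s.+1) * q ^+ s.+1 by rewrite -exprD subnK.
  by rewrite invfM mulrAC mulVf ?mul1r // expf_neq0.
by rewrite mulrAC.
Qed.

End Shift.

(** * Polynomials and matrices determined by values at powers of q *)

Section PowerZeros.
Variables (F : fieldType) (q : F).
Hypothesis q0 : q != 0.
Hypothesis hq : forall l : nat, (0 < l)%N -> q ^+ l != 1.

Lemma expq_inj : injective (fun k : nat => q ^+ k).
Proof.
have aux i j : (i < j)%N -> q ^+ i != q ^+ j.
  move=> lt; apply/eqP => e; have ji : (0 < j - i)%N by rewrite subn_gt0.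
  have /eqP[] := hq ji; apply: (@mulfI _ (q ^+ i)); first by rewrite expf_neq0.
  by rewrite -exprD subnKC ?mulr1 // ltnW.
move=> i j e; case: (ltngtP i j) => // /aux; last rewrite eq_sym.
  by rewrite e eqxx.
by rewrite e eqxx.
Qed.

(** The points q^k y are pairwise distinct, so there are more zeros than the degree allows. *)
Lemma poly_eq0_powers (p : {poly F}) (y : F) : y != 0 ->
  (forall k, p.[q ^+ k * y] = 0) -> p = 0.
Proof.
move=> y0 hp; pose rs := [seq q ^+ k * y | k <- iota 0 (size p)].
apply: (@roots_geq_poly_eq0 _ p rs).
- by apply/allP => z /mapP[k _ ->]; apply/rootP.
- rewrite map_inj_uniq ?iota_uniq // => i j e; apply: expq_inj.
  exact: mulIf e.
- by rewrite size_map size_iota.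
Qed.

End PowerZeros.

Section Rows.
Variables (F : fieldType) (M : nat).
Implicit Types A B : 'M[F]_M.+1.

Definition rowv A a (x : F) := \sum_(c < M.+1) A a c * x ^+ c.

Lemma rowv_mul A B a x : rowv (A *m B) a x = \sum_b A a b * rowv B b x.
Proof.
rewrite /rowv; under eq_bigr => c _ do rewrite mxE mulr_suml.
rewrite exchange_big; apply: eq_bigr => b _ /=; rewrite mulr_sumr.
by apply: eq_bigr => c _; rewrite mulrA.
Qed.

Lemma rowvZ c A a x : rowv (c *: A) a x = c * rowv A a x.
Proof.
by rewrite /rowv mulr_sumr; apply: eq_bigr => b _; rewrite mxE mulrA.
Qed.

Lemma rowv_scale A a c x : rowv A a (c * x) = \sum_b A a b * (c ^+ b * x ^+ b).
Proof. by apply: eq_bigr => b _; rewrite exprMn. Qed.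

(** The list [cs] holds the finitely many points at which a computation in x would divide by zero;
    multiplying the difference of the rows by the product of the x - c disposes of them. *)
Lemma rowv_inj (q : F) (cs : seq F) A B :
  q != 0 -> (forall l : nat, (0 < l)%N -> q ^+ l != 1) ->
  (forall a (x : F), x != 0 -> x \notin cs -> rowv A a x = rowv B a x) -> A = B.
Proof.
move=> q0 hq h; apply/matrixP => a b; apply/eqP; rewrite -subr_eq0; apply/eqP.
pose p := \poly_(c < M.+1) (A a (inord c) - B a (inord c)).
pose g := \prod_(c <- cs) ('X - c%:P).
have /eqP : p * g = 0.
  apply: (@poly_eq0_powers _ q q0 hq _ 1); first exact: oner_neq0.
  move=> k; rewrite mulr1 hornerM; case: (boolP (q ^+ k \in cs)) => hk.
    by rewrite (_ : g.[_] = 0) ?mulr0 //; apply/rootP; rewrite root_prod_XsubC.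
  rewrite horner_poly.
  have := h a (q ^+ k) (expf_neq0 _ q0) hk; rewrite /rowv => /eqP.
  rewrite -subr_eq0 -sumrB => /eqP e.
  rewrite -[RHS](mul0r g.[q ^+ k]); congr (_ * _).
  by rewrite -[RHS]e; apply: eq_bigr => c _; rewrite inord_val mulrBl.
rewrite mulf_eq0 [g == 0](negPf (monic_neq0 (monic_prod_XsubC _ _ _))) orbF => /eqP p0.
by have := congr1 (fun r : {poly F} => r`_b) p0; rewrite coef_poly ltn_ord inord_val coef0.
Qed.

(** Tridiagonal, with entries given as functions of the row number. The conditions pm 0 = 0 and pp M
    = 0 used below make missing neighbours harmless, including [0.-1], which is 0. *)
Definition trimx (pm p0 pp : nat -> F) : 'M[F]_M.+1 :=
  \matrix_(a, b) (if b.+1 == a then pm a else if b == a :> nat then p0 a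
                  else if b == a.+1 :> nat then pp a else 0).

Lemma trimx_sum pm p0 pp (f : nat -> F) (a : 'I_M.+1) : pm 0%N = 0 -> pp M = 0 ->
  \sum_b trimx pm p0 pp a b * f b = pm a * f a.-1 + p0 a * f a + pp a * f a.+1.
Proof.
move=> pm0 ppM.
pose g (c b : nat) (v : F) := if b == c then v * f b else 0.
have one (c : nat) (v : F) : ((c <= M)%N \/ v = 0) -> \sum_(b < M.+1) g c b v = v * f c.
  case=> [le|->]; last by rewrite mul0r big1 // => b _; rewrite /g mul0r if_same.
  rewrite (bigD1 (Ordinal (le : (c < M.+1)%N))) //= big1 ?addr0 => [|b ne].
    by rewrite /g eqxx.
  by rewrite /g; case: eqP => // e; case/eqP: ne; apply: val_inj.
have la : (a <= M)%N by rewrite -ltnS.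
rewrite -(one a.-1 (pm a)); last by left; lia.
rewrite -(one a (p0 a)); last by left.
rewrite -(one a.+1 (pp a)); last first.
  by case: (ltnP a M) => h; [left|right; rewrite (_ : nat_of_ord a = M) //; lia].
rewrite -!big_split /=; apply: eq_bigr => b _; rewrite mxE /g.
case: (nat_of_ord a) => [|a'] /=; rewrite ?eqSS ?pm0.
  case: (nat_of_ord b) => [|b']; rewrite /= ?mul0r ?add0r ?addr0 //.
  by rewrite eqSS; case: ifP => _; rewrite ?mul0r.
have [->|n1] := eqVneq (nat_of_ord b) a'.
  by rewrite !ifF ?addr0 //; apply/negbTE; lia.
have [->|n2] := eqVneq (nat_of_ord b) a'.+1.
  by rewrite !ifF ?addr0 ?add0r //; apply/negbTE; lia.
by rewrite !add0r; case: ifP; rewrite ?mul0r.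
Qed.

Lemma rowv_trimx pm p0 pp (a : 'I_M.+1) x : pm 0%N = 0 -> pp M = 0 -> x != 0 ->
  rowv (trimx pm p0 pp) a x = (pm a / x + p0 a + pp a * x) * x ^+ a.
Proof.
move=> h1 h2 x0; rewrite /rowv (trimx_sum _ (fun c => x ^+ c)) //.
case: (nat_of_ord a) => [|a'] /=; first by rewrite h1; ring.
by rewrite !exprS; field.
Qed.

Lemma rowv_trimxM pm p0 pp A (f : nat -> F) (a : 'I_M.+1) x : pm 0%N = 0 -> pp M = 0 ->
  (forall b : 'I_M.+1, rowv A b x = f b) ->
  rowv (trimx pm p0 pp *m A) a x = pm a * f a.-1 + p0 a * f a + pp a * f a.+1.
Proof.
move=> h1 h2 hf; rewrite rowv_mul -(trimx_sum _ f) //.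
by apply: eq_bigr => b _; rewrite hf.
Qed.

End Rows.

Lemma triangS (i : int) : triang (i + 1) = triang i + (i + 1).
Proof.
apply: (@mulIf _ 2) => //; rewrite mulrDl !triang2; ring.
Qed.

(** * Shift relations for the factors of R and for R *)

Section Rel.
Variables (F : fieldType) (q : F) (m n : nat) (d1 d4 : F).
Hypothesis q0 : q != 0.
Hypothesis hq : forall l : nat, (0 < l)%N -> q ^+ l != 1.
Local Notation M := (n + m)%N.

Definition rowA (al be : F) (a : nat) (x : F) : F :=
  q ^ triang (a%:Z - n%:Z) * Wprod q (M - a) (al * x) * (x ^+ a * Wprod q a (be / x)).

Definition Amx (al be L : F) : 'M[F]_M.+1 := map_mx (horner_eval L) (Bmx q m n al be).
Definition Rval (L : F) : 'M[F]_M.+1 := map_mx (horner_eval L) (Rmx q m n d1 d4).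

Lemma RvalE L : Rval L = Amx (- d1) (- d4) L *m Amx q 1 L.
Proof. by rewrite /Rval /Rmx map_mxM. Qed.

Lemma rowv_Amx al be L (a : 'I_M.+1) x : x != 0 ->
  rowv (Amx al be L) a x = rowA al (be * L) a x.
Proof.
move=> x0; have leaM : (a <= M)%N by rewrite -ltnS.
rewrite /rowv; under eq_bigr => c _ do rewrite !mxE /horner_eval.
by rewrite (row_Bentry q al be L leaM x0) !horner_xpoly // mulrA.
Qed.

(** With i = a - n, [zq a] is q^i; [ad] is d1 / q^(m+1), that is q c. *)
Let qn := q ^- n.
Let qm := q ^- m.
Let zq (a : nat) := q ^+ a * qn.
Let ad := d1 * qm / q.
Let b0 := d4 * qn.

(** The entries of Om are polynomials in q^i. [om_m] vanishes at i = -n and [om_p] at i = m, so Om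
    preserves the span of x^-n, ..., x^m. *)
Definition om_m (a : nat) : F := (zq a - qn) * (zq a - d4).
Definition om_0 (a : nat) : F :=
  (qm + d1 + ad * (qn + d4)) * zq a - (1 + q) * ad * zq a ^+ 2.
Definition om_p (a : nat) : F := ad * (1 - qm * zq a) * (1 - d1 * zq a).

Definition Om : 'M[F]_M.+1 := trimx M om_m om_0 om_p.

(* The ratio R (q L) R(L)^-1 is a pencil in the single matrix Om, hence these
   ratios commute for all values of L. *)
Definition Pmx (L : F) : 'M[F]_M.+1 := (1 + L ^+ 2 * ad * b0)%:M - L *: Om.

Lemma om_m0 : om_m 0 = 0.
Proof. by rewrite /om_m /zq expr0 mul1r subrr mul0r. Qed.

Lemma om_pM : om_p M = 0.
Proof.
have -> : om_p M = ad * (1 - qm * zq M) * (1 - d1 * zq M) by [].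
have -> : qm * zq M = 1 by rewrite /zq /qm /qn exprD; field; rewrite !expf_neq0.
by rewrite subrr mulr0 mul0r.
Qed.

Definition pm_m L a := - L * om_m a.
Definition pm_0 L a := 1 + L ^+ 2 * ad * b0 - L * om_0 a.
Definition pm_p L a := - L * om_p a.

Lemma PmxE L : Pmx L = trimx M (pm_m L) (pm_0 L) (pm_p L).
Proof.
clear q0 hq.
apply/matrixP => a b; rewrite !mxE; have [->|ne] := eqVneq a b.
  have -> : (b.+1 == b) = false by apply/negbTE; lia.
  by rewrite eqxx mulr1n.
have -> : (b == a :> nat) = false by apply/negbTE; rewrite eq_sym.
by do 2?case: ifP => _; rewrite /pm_m /pm_p mulr0n; ring.
Qed.

Lemma PmxC L L' : Pmx L *m Pmx L' = Pmx L' *m Pmx L.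
Proof.
have cZ (A B : 'M[F]_M.+1) c : comm_mx A B -> comm_mx A (c *: B).
  by rewrite /comm_mx -scalemxAr -scalemxAl => ->.
apply: comm_mxB; first exact: comm_mx_scalar.
apply/cZ/comm_mx_sym/comm_mxB; first exact: comm_mx_scalar.
exact: cZ.
Qed.

Definition Rscal1 L := 1 - L / q ^+ M.
Definition Rscal2 L := 1 - L * ad * b0.

Lemma triang_step (a : nat) :
  q ^ triang (a.+1%:Z - n%:Z) = q ^ triang (a%:Z - n%:Z) * (q ^+ a.+1 * qn).
Proof.
have -> : a.+1%:Z - n%:Z = (a%:Z - n%:Z) + 1 by lia.
rewrite triangS expfzDr //; congr (_ * _).
have -> : a%:Z - n%:Z + 1 = a.+1%:Z - n%:Z by lia.
by rewrite expfzDr // -exprnN.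
Qed.

(** The bidiagonal factor produced when A(q, Lambda) is shifted; [Amx2_shift] absorbs it into the
    shift of the other factor. *)
Definition Z1 L : 'M[F]_M.+1 :=
  trimx M (fun a => - L * qn * (q ^+ a - 1)) (fun a => 1 - L * q ^+ a / q ^+ M) (fun=> 0).

Lemma Amx1_shift L : Rscal1 L *: Amx q 1 (q * L) = Z1 L *m Amx q 1 L.
Proof.
apply: (rowv_inj (cs := [::]) q0 hq) => a x x0 _; have leaM : (a <= M)%N by rewrite -ltnS.
rewrite rowvZ rowv_Amx // !mul1r.
rewrite (@rowv_trimxM _ _ _ _ _ _ (fun b => rowA q L b x)) ?expr0 ?subrr ?mulr0 //; last first.
  by move=> b; rewrite rowv_Amx // mul1r.
rewrite mul0r addr0 /Rscal1; case ea: (nat_of_ord a) => [|a'] /=.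
  by rewrite /rowA !Wprod0 expr0; ring.
have eM : (M - a' = (M - a'.+1).+1)%N by lia.
have eqM : q ^+ M = q ^+ (M - a'.+1) * (q * q ^+ a') by rewrite -exprS -exprD; congr (_ ^+ _); lia.
rewrite /rowA eM (WprodS q (M - a'.+1)) !triang_step eqM.
rewrite -[q * L / x]mulrA Wprod_shift // WprodS !exprS.
have := expf_neq0 a' q0; have := expf_neq0 (M - a'.+1) q0; have := expf_neq0 n q0.
rewrite /qn; move: (q ^+ a') (q ^+ (M - a'.+1)) (q ^+ n) (q ^ _).
move: (Wprod q _ (q * x)) (Wprod q a' _) (x ^+ a').
by move=> W1 W2 X A K N T hN hK hA; field; rewrite ?hN ?hK ?hA ?q0 ?x0.
Qed.


Lemma PmxM_row L (A : 'M[F]_M.+1) (f : nat -> F) (a : 'I_M.+1) x :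
  (forall b : 'I_M.+1, rowv A b x = f b) ->
  rowv (Pmx L *m A) a x = pm_m L a * f a.-1 + pm_0 L a * f a + pm_p L a * f a.+1.
Proof.
rewrite PmxE; apply: rowv_trimxM; first by rewrite /pm_m om_m0 mulr0.
by rewrite /pm_p om_pM mulr0.
Qed.

Lemma neq1_div (be x : F) : x != 0 -> x != be -> 1 - be / x != 0.
Proof.
move=> x0 h; rewrite subr_eq0; apply: contraNneq h => e.
by rewrite -[be](divfK x0) -e mul1r.
Qed.

(** The factor q^a - 1 vanishes at a = 0, where [a.-1] is not the preceding index. Elsewhere row a -
    1 is expressed by the products of row a, at the cost of a pole at x = be. In [rowA_succ] the
    factor 1 - q^(M-a) does the same at a = M. *)
Lemma rowA_pred al be (a : nat) x : (a <= M)%N -> x != 0 -> x != be ->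
  (q ^+ a - 1) * rowA al be a.-1 x = (q ^+ a - 1) *
    (q ^ triang (a%:Z - n%:Z) / (q ^+ a * qn) *
     (Wprod q (M - a) (al * x) * (1 - al * x / (q * q ^+ (M - a)))) *
     (x ^+ a / x * (Wprod q a (q * (be / x)) / (1 - be / x)))).
Proof.
case: a => [|a] aM x0 xb /=; first by rewrite expr0 subrr !mul0r.
congr (_ * _); rewrite /rowA (_ : (M - a = (M - a.+1).+1)%N); last by lia.
rewrite WprodS Wprod_shift // triang_step.
have h := neq1_div x0 xb.
rewrite -(exprS q (M - a.+1)).
have hA := expf_neq0 a.+1 q0; have hN : qn != 0 by rewrite invr_eq0 expf_neq0.
have hK := expf_neq0 (M - a.+1).+1 q0.
rewrite [(1 - be / x) * _]mulrC (mulfK h) (exprSr x a) (mulfK x0).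
by rewrite mulfK ?mulf_neq0.
Qed.

Lemma rowA_succ al be (a : nat) x : (a <= M)%N -> al * x != 1 ->
  (1 - q ^+ (M - a)) * rowA al be a.+1 x = (1 - q ^+ (M - a)) *
    (q ^ triang (a%:Z - n%:Z) * (q ^+ a * q * qn) *
     (Wprod q (M - a) (q * (al * x)) / (1 - al * x)) *
     (x ^+ a * x * (Wprod q a (be / x) * (1 - be / x / (q * q ^+ a))))).
Proof.
move=> aM xa; case e: (M - a)%N => [|k]; first by rewrite expr0 subrr !mul0r.
congr (_ * _); rewrite /rowA (_ : (M - a.+1 = k)%N); last by lia.
have h : 1 - al * x != 0 by rewrite subr_eq0 eq_sym.
rewrite Wprod_shift // WprodS triang_step [(1 - al * x) * _]mulrC mulfK //.
by rewrite !exprS ![_ ^+ a * _]mulrC.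
Qed.

Lemma neq1_mul (al x : F) : x != al^-1 -> al * x != 1.
Proof.
move=> h; apply: contraNneq h => e; apply/eqP; apply: (@mulfI _ al).
  by apply: contraTneq (oner_neq0 F) => al0; rewrite -e al0 mul0r eqxx.
by rewrite e divff //; apply: contraTneq (oner_neq0 F) => al0; rewrite -e al0 mul0r eqxx.
Qed.

Lemma Wprod_q k z : z != 1 -> Wprod q k z = Wprod q k (q * z) * (1 - z / q ^+ k) / (1 - z).
Proof.
by move=> h; rewrite -Wprod_shiftl // mulrC mulrA mulVf ?mul1r // subr_eq0 eq_sym.
Qed.

Lemma Amx2_shift L :
  Rscal2 L *: (Amx (- d1) (- d4) (q * L) *m Z1 L) = Pmx L *m Amx (- d1) (- d4) L.
Proof.
apply: (rowv_inj (cs := [:: (- d1)^-1; - d4 * L]) q0 hq) => a x x0.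
have leaM : (a <= M)%N by rewrite -ltnS.
rewrite !inE negb_or => /andP[/neq1_mul xa xb]; have xb' := neq1_div x0 xb.
rewrite rowvZ (@PmxM_row _ _ (fun b => rowA (- d1) (- d4 * L) b x)); last first.
  by move=> b; rewrite rowv_Amx.
set B := Amx _ _ _.
(* The entries of [Z1] are affine in q^b, so multiplying by it on the right is a q-difference
   operator in x. *)
transitivity (Rscal2 L * ((1 + L * qn / x) * rowv B a x -
                      (L / q ^+ M + L * qn / x) * rowv B a (q * x))).
  congr (_ * _); rewrite rowv_mul rowv_scale /rowv !mulr_sumr -sumrB.
  apply: eq_bigr => b _; rewrite -/(rowv _ _ _) rowv_trimx ?expr0 ?subrr ?mulr0 //.
  by field; rewrite x0 expf_neq0.
have qx0 : q * x != 0 by rewrite mulf_neq0.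
rewrite !rowv_Amx //.
have hN := expf_neq0 n q0; have hA := expf_neq0 a q0; have hK := expf_neq0 (M - a) q0.
have eM : q ^+ M = q ^+ a * q ^+ (M - a) by rewrite -exprD subnKC.
have em : q ^+ m = q ^+ a * q ^+ (M - a) / q ^+ n.
  by rewrite -eM exprD mulrAC divff // mul1r.
have -> : pm_m L a * rowA (- d1) (- d4 * L) a.-1 x =
    - L * qn * (zq a - d4) * ((q ^+ a - 1) * rowA (- d1) (- d4 * L) a.-1 x).
  by rewrite /pm_m /om_m /zq; ring.
have -> : pm_p L a * rowA (- d1) (- d4 * L) a.+1 x =
    L * ad * (1 - d1 * zq a) / q ^+ (M - a) *
    ((1 - q ^+ (M - a)) * rowA (- d1) (- d4 * L) a.+1 x).
  rewrite /pm_p /om_p /zq /qm em /qn; move: hN hA hK.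
  move: (q ^+ n) (q ^+ a) (q ^+ (M - a)) (rowA _ _ _ _) ad => N A K r d hN hA hK.
  by field; rewrite hN hA hK.
rewrite rowA_pred // rowA_succ // /rowA.
have -> : - d4 * (q * L) / x = q * (- d4 * L / x) by ring.
have -> : - d4 * (q * L) / (q * x) = - d4 * L / x by field; rewrite x0 q0.
have -> : - d1 * (q * x) = q * (- d1 * x) by ring.
(* All products are reduced to the two at arguments multiplied by q, which leaves an identity of
   rational functions. *)
rewrite (Wprod_q (M - a) xa) (@Wprod_q a (- d4 * L / x)); last first.
  by rewrite -subr_eq0 -opprB oppr_eq0.
rewrite /Rscal2 /pm_0 /om_0 /zq /ad /b0 /qm em eM /qn exprMn.
have xa' : 1 - - d1 * x != 0 by rewrite subr_eq0 eq_sym.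
move: hN hA hK xa' xb'.
move: (q ^+ n) (q ^+ a) (q ^+ (M - a)) (Wprod q a _) (Wprod q _ _) (x ^+ a) (q ^ _).
move=> N A K W1 W2 X T hN hA hK xa' xb'.
by field; rewrite hN hA hK x0 q0 xa' subr_eq0 xb.
Qed.


(** Shifting the right factor creates [Z1], and shifting the left factor consumes it and creates
    [Pmx]. *)
Lemma Rval_shift L : (Rscal1 L * Rscal2 L) *: Rval (q * L) = Pmx L *m Rval L.
Proof.
rewrite !RvalE mulmxA -Amx2_shift -scalemxAl -mulmxA -Amx1_shift -scalemxAr scalerA.
by rewrite mulrC.
Qed.

(** The matrix S of the substitution x -> q x; [conjS A] is S^-1 A S. *)
Definition qdiag : 'M[F]_M.+1 := diag_mx (\row_a q ^+ a).
Definition conjS (A : 'M[F]_M.+1) : 'M[F]_M.+1 := \matrix_(a, b) (q ^- a * A a b * q ^+ b).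

Lemma qdiag_conjS A : qdiag *m conjS A = A *m qdiag.
Proof.
apply/matrixP => a b; rewrite mul_diag_mx mul_mx_diag !mxE.
by rewrite !mulrA mulfV ?mul1r ?expf_neq0.
Qed.

Lemma conjSM A B : conjS (A *m B) = conjS A *m conjS B.
Proof.
apply/matrixP => a b; rewrite !mxE mulr_sumr mulr_suml; apply: eq_bigr => c _.
by rewrite !mxE; field; rewrite !expf_neq0.
Qed.

Lemma rowv_conjS A a x : rowv (conjS A) a x = q ^- a * rowv A a (q * x).
Proof.
rewrite rowv_scale mulr_sumr; apply: eq_bigr => b _; rewrite mxE.
by rewrite !mulrA.
Qed.

Lemma rowv_conjS_Amx al be L (a : 'I_M.+1) x : x != 0 ->
  rowv (conjS (Amx al be (q * L))) a x = rowA (q * al) (be * L) a x.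
Proof.
move=> x0; have qx0 : q * x != 0 by rewrite mulf_neq0.
rewrite rowv_conjS rowv_Amx // /rowA exprMn.
have -> : be * (q * L) / (q * x) = be * L / x by field; rewrite x0 q0.
have -> : al * (q * x) = q * al * x by ring.
by field; rewrite expf_neq0.
Qed.

(** The analogue of [Z1] for the shift combined with conjugation by S. It is created by A(-d1, -d4
    Lambda) and consumed by A(q, Lambda). *)
Definition Z2 L : 'M[F]_M.+1 :=
  trimx M (fun=> 0) (fun b => 1 - ad * d4 * L * zq b) (fun b => d1 * (1 - qm * zq b)).

Lemma qm_zzM : qm * zq M = 1.
Proof. by rewrite /zq /qm /qn exprD; field; rewrite !expf_neq0. Qed.

Lemma conjS_Amx2 L :
  Rscal2 L *: conjS (Amx (- d1) (- d4) (q * L)) = Amx (- d1) (- d4) L *m Z2 L.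
Proof.
apply: (rowv_inj (cs := [:: (- d1)^-1; - d4 * L / q]) q0 hq) => a x x0.
have leaM : (a <= M)%N by rewrite -ltnS.
have qx0 : q * x != 0 by rewrite mulf_neq0.
rewrite !inE negb_or => /andP[/neq1_mul xa xb].
have xb' : 1 - - d4 * L / (q * x) != 0.
  by apply: neq1_div => //; apply: contraNneq xb => <-; rewrite mulrAC divff ?mul1r.
set B := Amx _ _ L.
transitivity ((1 + d1 * x) * rowv B a x - (q * ad * x + ad * d4 * L) * qn * rowv B a (q * x)).
  rewrite rowvZ rowv_conjS_Amx // !rowv_Amx // /rowA.
  have e : - d4 * L / x = q * (- d4 * L / (q * x)) by field; rewrite x0 q0.
  rewrite e (Wprod_q (M - a) xa) (@Wprod_q a (- d4 * L / (q * x))) -?e; last first.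
    by rewrite eq_sym -subr_eq0.
  have -> : q * - d1 * x = q * (- d1 * x) by ring.
  have -> : - d1 * (q * x) = q * (- d1 * x) by ring.
  have hN := expf_neq0 n q0; have hA := expf_neq0 a q0; have hK := expf_neq0 (M - a) q0.
  have eM : q ^+ M = q ^+ a * q ^+ (M - a) by rewrite -exprD subnKC.
  have em : q ^+ m = q ^+ a * q ^+ (M - a) / q ^+ n.
    by rewrite -eM exprD mulrAC divff // mul1r.
  rewrite /Rscal2 /ad /b0 /qm em /qn exprMn.
  have xa' : 1 - - d1 * x != 0 by rewrite subr_eq0 eq_sym.
  have xb'' : q * x - - d4 * L != 0.
    by move: xb'; rewrite -(mulfV qx0) -mulrBl mulf_eq0 negb_or => /andP[].
  move: hN hA hK xa' xb''.
  move: (q ^+ n) (q ^+ a) (q ^+ (M - a)) (Wprod q a _) (Wprod q _ _) (x ^+ a) (q ^ _).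
  move=> N A K W1 W2 X T hN hA hK xa' xb''.
  by field; rewrite hN hA hK x0 q0 xa' xb''.
rewrite rowv_mul rowv_scale /rowv !mulr_sumr -sumrB; apply: eq_bigr => b _.
rewrite -/(rowv _ _ _) rowv_trimx //; last by rewrite qm_zzM subrr mulr0.
by rewrite /zq /ad; field; rewrite x0 q0.
Qed.

(** Entries of E_(c L) P(L) E_(c L)^-1 written out without inverses, hence polynomial in L; see
    [Phmx_powdiag]. The diagonal is that of P(L). *)
Definition ph_m L (b : nat) : F := - (ad / q) * L ^+ 2 * om_m b.
Definition ph_p (b : nat) : F := - q * (1 - qm * zq b) * (1 - d1 * zq b).
Definition Phmx L : 'M[F]_M.+1 := trimx M (ph_m L) (pm_0 L) ph_p.

Lemma conjS_Amx1 L :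
  Rscal1 L *: (Z2 L *m conjS (Amx q 1 (q * L))) = Amx q 1 L *m Phmx L.
Proof.
(* The excluded points are the zeros of 1 - q x, 1 - q^2 x, q x - L and q^2 x - L, the denominators
   met below. *)
apply: (rowv_inj (cs := [:: q^-1; (q ^+ 2)^-1; L / q; L / q ^+ 2]) q0 hq) => a x x0.
have leaM : (a <= M)%N by rewrite -ltnS.
have qx0 : q * x != 0 by rewrite mulf_neq0.
have qqx0 : q * (q * x) != 0 by rewrite mulf_neq0.
rewrite !inE !negb_or => /and4P[/neq1_mul xa /neq1_mul xa2 xb xb2].
have xb' : q * x - L != 0.
  by rewrite subr_eq0; apply: contraNneq xb => <-; rewrite mulrAC divff ?mul1r.
have xb2' : q ^+ 2 * x - L != 0.
  by rewrite subr_eq0; apply: contraNneq xb2 => <-; rewrite mulrAC divff ?mul1r ?expf_neq0.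
set B := Amx _ _ L.
(* The entries of [Phmx] are quadratic in q^b, so multiplying by it involves the values at x, q x
   and q^2 x. *)
transitivity (- (ad / q) * L ^+ 2 / x *
    (rowv B a (q * (q * x)) * qn ^+ 2 - (qn + d4) * qn * rowv B a (q * x) + qn * d4 * rowv B a x) +
  ((1 + L ^+ 2 * ad * b0) * rowv B a x
    - L * ((qm + d1 + ad * (qn + d4)) * qn * rowv B a (q * x)
    - (1 + q) * ad * qn ^+ 2 * rowv B a (q * (q * x)))) +
  - q * x * (rowv B a x - (qm + d1) * qn * rowv B a (q * x) +
             qm * d1 * qn ^+ 2 * rowv B a (q * (q * x)))); last first.
  rewrite rowv_mul !rowv_scale /rowv !(mulr_sumr, mulr_suml, =^~ sumrB, =^~ big_split) /=.
  apply: eq_bigr => b _.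
  rewrite -/(rowv _ _ _) rowv_trimx //; last 2 first.
  - by rewrite /ph_m om_m0 mulr0.
  - by rewrite /ph_p qm_zzM subrr mulr0 mul0r.
  rewrite /ph_m /pm_0 /ph_p /om_m /om_0 /zq [(q * x) ^+ b]exprMn.
  move: (q ^+ b) (x ^+ b) (B a b) => K X r.
  by field; rewrite x0 q0.
rewrite rowvZ (@rowv_trimxM _ _ _ _ _ _ (fun b => rowA (q * q) L b x)) //; last first.
- by move=> b; rewrite rowv_conjS_Amx // mul1r.
- by rewrite qm_zzM subrr mulr0.
rewrite mul0r add0r !rowv_Amx // !mul1r.
have hN := expf_neq0 n q0; have hA := expf_neq0 a q0; have hK := expf_neq0 (M - a) q0.
have eM : q ^+ M = q ^+ a * q ^+ (M - a) by rewrite -exprD subnKC.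
have em : q ^+ m = q ^+ a * q ^+ (M - a) / q ^+ n.
  by rewrite -eM exprD mulrAC divff // mul1r.
have -> : d1 * (1 - qm * zq a) * rowA (q * q) L a.+1 x =
    - d1 / q ^+ (M - a) * ((1 - q ^+ (M - a)) * rowA (q * q) L a.+1 x).
  rewrite /zq /qm em /qn; move: hN hA hK.
  move: (q ^+ n) (q ^+ a) (q ^+ (M - a)) (rowA _ _ _ _) => N A K r hN hA hK.
  by field; rewrite hN hA hK.
have qqx1 : q * q * x != 1 by rewrite -expr2.
rewrite rowA_succ // /rowA.
have e1 : L / x = q * (L / (q * x)) by field; rewrite x0 q0.
have e2 : L / (q * x) = q * (L / (q * (q * x))) by field; rewrite x0 q0.
have n1 : L / (q * x) != 1 by rewrite eq_sym -subr_eq0 neq1_div // -subr_eq0.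
have n2 : L / (q * (q * x)) != 1.
  by rewrite eq_sym -subr_eq0 neq1_div // -subr_eq0 mulrA -expr2.
rewrite (Wprod_q a n2) -e2 (Wprod_q a n1) -e1.
rewrite (Wprod_q (M - a) xa) (_ : q * (q * x) = q * q * x); last by rewrite mulrA.
rewrite (Wprod_q (M - a) qqx1) (_ : q * (q * q * x) = q * q * q * x); last by rewrite !mulrA.
rewrite /Rscal1 /pm_0 /om_0 /zq /ad /b0 /qm em eM /qn !exprMn.
have xa' : 1 - q * x != 0 by rewrite subr_eq0 eq_sym.
have xa2' : 1 - q * q * x != 0 by rewrite subr_eq0 eq_sym.
rewrite expr2 in xb2'.
move: hN hA hK xa' xa2' xb' xb2'.
move: (q ^+ n) (q ^+ a) (q ^+ (M - a)) (Wprod q a _) (Wprod q _ _) (x ^+ a) (q ^ _).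
move=> N A K W1 W2 X T hN hA hK xa' xa2' xb' xb2'.
by field; rewrite hN hA hK x0 q0 xa' xa2' xb' xb2'.
Qed.

Lemma Rval_conj_shift L :
  (Rscal1 L * Rscal2 L) *: (Rval (q * L) *m qdiag) = qdiag *m Rval L *m Phmx L.
Proof.
rewrite !RvalE -qdiag_conjS conjSM scalemxAr -mulmxA; congr (_ *m _).
rewrite -mulmxA -conjS_Amx1 -scalemxAr mulmxA -conjS_Amx2 -scalemxAl scalerA.
by [].
Qed.

End Rel.

(** * Commutation of R at two arguments *)

Section Comm.
Variables (F : fieldType) (q : F) (m n : nat) (d1 d4 : F).
Hypothesis q0 : q != 0.
Hypothesis hq : forall l : nat, (0 < l)%N -> q ^+ l != 1.
Local Notation M := (n + m)%N.
Local Notation R := (Rval q m n d1 d4).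
Local Notation P := (Pmx q m n d1 d4).
Local Notation s L := (Rscal1 q m n L * Rscal2 q m n d1 d4 L).
Let c := d1 / q ^+ (m + 2).

Definition powdiag (z : F) : 'M[F]_M.+1 := diag_mx (\row_a z ^+ a).

Lemma powdiagM z w : powdiag z *m powdiag w = powdiag (z * w).
Proof.
apply/matrixP => a b; rewrite /powdiag mul_diag_mx !mxE.
by case: (a == b); rewrite ?mulr1n ?mulr0n ?mulr0 // exprMn.
Qed.

Lemma mul_powdiag (z : F) (A : 'M[F]_M.+1) a b : (powdiag z *m A) a b = z ^+ a * A a b.
Proof. by rewrite /powdiag mul_diag_mx !mxE. Qed.

Lemma horner_Rmx (L : F) a b : (Rmx q m n d1 d4 a b).[L] = R L a b.
Proof. by rewrite [RHS]mxE. Qed.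

Lemma powdiagC z w : powdiag z *m powdiag w = powdiag w *m powdiag z.
Proof. by rewrite !powdiagM mulrC. Qed.

Lemma Phmx_powdiag y : Phmx q m n d1 d4 y *m powdiag (c * y) = powdiag (c * y) *m P y.
Proof.
have e2 : c = d1 / q ^+ m / q / q.
  by rewrite /c exprD expr2 !invfM !mulrA.
apply/matrixP => a b; rewrite PmxE /Phmx /powdiag mul_diag_mx mul_mx_diag !mxE.
case: eqP => [e|_].
  have -> : (c * y) ^+ a = (c * y) ^+ b.+1 by rewrite e.
  by rewrite exprS /ph_m /pm_m e2; ring.
case: eqP => [->|_]; first by rewrite mulrC.
case: eqP => [->|_]; last by rewrite mulr0 mul0r.
by rewrite exprS /ph_p /pm_p /om_p e2; field; rewrite q0 !expf_neq0.
Qed.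

Fixpoint Pprod (y : F) (k : nat) : 'M[F]_M.+1 :=
  if k is k'.+1 then P (q ^+ k' * y) *m Pprod y k' else 1%:M.

Lemma PprodC y k L : Pprod y k *m P L = P L *m Pprod y k.
Proof.
elim: k => [|k IH] /=; first by rewrite mul1mx mulmx1.
by rewrite -mulmxA IH !mulmxA PmxC.
Qed.

Lemma Rval_iter y k :
  (\prod_(j < k) s (q ^+ j * y)) *: R (q ^+ k * y) = Pprod y k *m R y.
Proof.
elim: k => [|k IH]; first by rewrite big_ord0 expr0 mul1r scale1r mul1mx.
rewrite big_ord_recr /= -scalerA exprS -mulrA Rval_shift // -mulmxA -IH.
by rewrite -scalemxAr.
Qed.

(** Conjugation by E turns each [Phmx] into [Pmx], so the same product [Pprod y k] appears as in
    [Rval_iter], now on the right. *)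
Lemma Rval_powdiag_iter y k :
  (\prod_(j < k) s (q ^+ j * y)) *: (R (q ^+ k * y) *m powdiag (c * (q ^+ k * y))) =
  powdiag (q ^+ k) *m (R y *m powdiag (c * y) *m Pprod y k).
Proof.
elim: k => [|k IH].
  rewrite big_ord0 !expr0 mul1r scale1r mulmx1 (_ : powdiag 1 = 1%:M) ?mul1mx //.
  by apply/matrixP => a b; rewrite !mxE expr1n.
rewrite big_ord_recr /= -scalerA exprS -mulrA; set L := q ^+ k * y.
have -> : powdiag (c * (q * L)) = qdiag q m n *m powdiag (c * L).
  by rewrite powdiagM; congr powdiag; ring.
rewrite mulmxA scalemxAl (Rval_conj_shift m n d1 d4 q0 hq) -!mulmxA Phmx_powdiag.
rewrite scalemxAr [R L *m _]mulmxA scalemxAl IH -PprodC.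
by rewrite -!mulmxA mulmxA [qdiag _ _ _ *m _]powdiagM.
Qed.

(** After multiplication by the nonzero scalar [sg] both sides equal E_(c L) R(y) E_(c y) Pprod
    R(y). *)
Lemma Rval_comm y k : (forall j, s (q ^+ j * y) != 0) ->
  let L := q ^+ k * y in
  powdiag (c * y) *m R L *m (powdiag (c * L) *m R y) =
  powdiag (c * L) *m R y *m (powdiag (c * y) *m R L).
Proof.
move=> hs L; set sg := \prod_(j < k) s (q ^+ j * y).
have sg0 : sg != 0 by apply/prodf_neq0 => j _; exact: hs.
apply: (scalerI sg0).
have -> : sg *: (powdiag (c * y) *m R L *m (powdiag (c * L) *m R y)) =
    powdiag (c * y) *m (sg *: (R L *m powdiag (c * L))) *m R y.
  by rewrite -scalemxAr -scalemxAl -!mulmxA.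
have -> : sg *: (powdiag (c * L) *m R y *m (powdiag (c * y) *m R L)) =
    powdiag (c * L) *m R y *m powdiag (c * y) *m (sg *: R L).
  by rewrite -scalemxAr -!mulmxA.
rewrite Rval_powdiag_iter Rval_iter -!mulmxA [LHS]mulmxA [powdiag _ *m powdiag _]powdiagM.
by congr (powdiag _ *m _); rewrite /L; ring.
Qed.

(* Both sides are polynomials in L which agree at all the points q^k y. *)
Lemma Rmx_comm (y : F) (l k : 'I_M.+1) : y != 0 -> (forall j, s (q ^+ j * y) != 0) ->
  \sum_(j < M.+1) ((c * y) ^+ l * c ^+ j * R y j k) *: ('X^j * Rmx q m n d1 d4 l j) =
  \sum_(j < M.+1) (c ^+ l * R y l j * (c * y) ^+ j) *: ('X^l * Rmx q m n d1 d4 j k).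
Proof.
move=> y0 hs; apply/eqP; rewrite -subr_eq0; apply/eqP.
apply: (poly_eq0_powers q0 hq y0) => e; set L := q ^+ e * y.
have := congr1 (fun A : 'M_M.+1 => A l k) (Rval_comm e hs).
rewrite -/L -!mulmxA !mul_powdiag hornerD hornerN !horner_sum => h.
apply/eqP; rewrite subr_eq0; apply/eqP.
transitivity ((c * y) ^+ l * (R L *m (powdiag (c * L) *m R y)) l k).
  rewrite mxE mulr_sumr; apply: eq_bigr => j _.
  by rewrite hornerZ hornerM hornerXn horner_Rmx mul_powdiag [(c * L) ^+ j]exprMn; ring.
rewrite h mxE mulr_sumr; apply: eq_bigr => j _.
by rewrite hornerZ hornerM hornerXn horner_Rmx mul_powdiag [(c * L) ^+ l]exprMn; ring.
Qed.

End Comm.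

(** * The solution of the difference equation *)
Section Series1.
Variable F : fieldType.
Implicit Types (f g h : nat -> F).



Definition psshift (l : nat) f (N : nat) : F := if (l <= N)%N then f (N - l)%N else 0.

Lemma psshiftE l f : psshift l f = psmul (fun k => (k == l)%:R) f.
Proof.
apply: functional_extensionality => N; rewrite /psshift /psmul; case: ifP => h.
  have h' : (l < N.+1)%N by [].
  rewrite (bigD1 (Ordinal h')) //= eqxx mul1r big1 ?addr0 // => i ne.
  by case: eqP => [e|]; rewrite ?mul0r //; case/eqP: ne; apply: val_inj.
rewrite big1 // => i _; case: eqP => [e|]; last by rewrite mul0r.
by move: h; rewrite -e -ltnS ltn_ord.
Qed.

Lemma psmul_shiftr l f g : psmul f (psshift l g) = psshift l (psmul f g).
Proof. by rewrite !psshiftE !psmulA [psmul f _]psmulC. Qed.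

Lemma psmul_shiftl l f g : psmul (psshift l f) g = psshift l (psmul f g).
Proof. by rewrite !psshiftE psmulA. Qed.

Lemma psdil_shift u l f : psdil u (psshift l f) = fun N => u ^+ l * psshift l (psdil u f) N.
Proof.
apply: functional_extensionality => N; rewrite /psdil /psshift.
by case: ifP => h; rewrite ?mulr0 // mulrA -exprD subnKC.
Qed.

Lemma psmul_sumr (I : finType) f (a : I -> F) (g : I -> nat -> F) :
  psmul f (fun N => \sum_i a i * g i N) = fun N => \sum_i a i * psmul f (g i) N.
Proof.
apply: functional_extensionality => N; rewrite /psmul.
under [RHS]eq_bigr => i _ do rewrite mulr_sumr.
rewrite [RHS]exchange_big; apply: eq_bigr => k _ /=; rewrite mulr_sumr.
by apply: eq_bigr => i _; rewrite mulrCA.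
Qed.

Lemma psmul_suml (I : finType) f (a : I -> F) (g : I -> nat -> F) :
  psmul (fun N => \sum_i a i * g i N) f = fun N => \sum_i a i * psmul (g i) f N.
Proof.
rewrite psmulC psmul_sumr; apply: functional_extensionality => N.
by apply: eq_bigr => i _; rewrite psmulC.
Qed.

Lemma psmulZl f a g : psmul (fun N => a * g N) f = fun N => a * psmul g f N.
Proof.
apply: functional_extensionality => N; rewrite /psmul mulr_sumr.
by apply: eq_bigr => k _; rewrite mulrA.
Qed.

Lemma psdil_sum u (I : finType) (a : I -> F) (g : I -> nat -> F) :
  psdil u (fun N => \sum_i a i * g i N) = fun N => \sum_i a i * psdil u (g i) N.
Proof.
apply: functional_extensionality => N; rewrite /psdil mulr_sumr.
by apply: eq_bigr => i _; rewrite mulrCA.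
Qed.

Lemma psshift_sum l (I : finType) (a : I -> F) (g : I -> nat -> F) :
  psshift l (fun N => \sum_i a i * g i N) = fun N => \sum_i a i * psshift l (g i) N.
Proof.
apply: functional_extensionality => N; rewrite /psshift; case: ifP => // _.
by rewrite big1 // => i _; rewrite mulr0.
Qed.


Lemma psmul_inj f g h : f 0%N != 0 -> psmul f g = psmul f h -> g = h.
Proof.
move=> f0 e; apply: functional_extensionality => N.
elim/ltn_ind: N => N IH; apply: (mulfI f0).
have := congr1 (fun k => k N) e; rewrite /psmul !big_ord_recl /= subn0.
rewrite (eq_bigr (fun i : 'I_N => f (bump 0 i) * h (N - bump 0 i)%N)); first exact: addIr.
by move=> i _; rewrite IH // /bump; have := ltn_ord i; lia.
Qed.

End Series1.

(** * The recursion in Lambda and uniqueness of its solutions *)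

Section Solution.
Variables (F : fieldType) (m n : nat) (q t d1 d4 Q : F).
Hypothesis gen : generic q t d1 d4 Q.
Local Notation M := (n + m)%N.
Let c := d1 / q ^+ (m + 2).
Let y := q ^+ (m + 2) / d1 * Q.

Lemma gen_q0 : q != 0. Proof. by case: gen => -[]. Qed.
Lemma gen_t0 : t != 0. Proof. by case: gen => -[]. Qed.
Lemma gen_d10 : d1 != 0. Proof. by case: gen => -[]. Qed.
Lemma gen_d40 : d4 != 0. Proof. by case: gen => -[]. Qed.
Lemma gen_Q0 : Q != 0. Proof. by case: gen => -[]. Qed.
Hint Resolve gen_q0 gen_t0 gen_d10 gen_d40 gen_Q0 : core.

Lemma gen_neq1 (a b c' d e : int) :
  [|| a != 0, b != 0, c' != 0, d != 0 | e != 0] ->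
  q ^ a * t ^ b * d1 ^ c' * d4 ^ d * Q ^ e != 1.
Proof.
move=> h; apply/eqP; case: gen => _ hg /hg [a0 b0 c0 e0 f0].
by move: h; rewrite a0 b0 c0 e0 f0.
Qed.

Lemma gen_neq1Q (a c' d : int) : q ^ a * d1 ^ c' * d4 ^ d * Q != 1.
Proof.
have := @gen_neq1 a 0 c' d 1; rewrite expr0z mulr1 expr1z; apply.
by rewrite !orbT.
Qed.

Lemma gen_hq (l : nat) : (0 < l)%N -> q ^+ l != 1.
Proof.
case: l => // l _; have := @gen_neq1 l.+1 0 0 0 0 isT.
by rewrite !expr0z !mulr1.
Qed.

Lemma gen_y0 : y != 0.
Proof. by rewrite !mulf_neq0 ?invr_eq0 ?expf_neq0. Qed.

(** The quantity subtracted from 1 is a power of q times Q / d1 in the first scalar and times d4 Q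
    in the second; genericity excludes the value 1. *)
Lemma gen_s (j : nat) : Rscal1 q m n (q ^+ j * y) * Rscal2 q m n d1 d4 (q ^+ j * y) != 0.
Proof.
rewrite mulf_neq0 // subr_eq0 eq_sym.
  have := gen_neq1Q (j%:Z + (m + 2)%N%:Z - (n + m)%N%:Z) (-1) 0.
  rewrite !expr0z !mulr1 exprN1 !expfzDr // -exprnN; apply: contra => /eqP e.
  by apply/eqP; rewrite -[RHS]e -!exprnP /y; field; rewrite gen_d10 expf_neq0.
have := gen_neq1Q (j%:Z + 1 - n%:Z) 0 1.
rewrite !expr0z !mulr1 expr1z !expfzDr // -exprnN expr1z; apply: contra => /eqP e.
apply/eqP; rewrite -[RHS]e -!exprnP /y exprD.
by field; rewrite gen_d10 gen_q0 !expf_neq0.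
Qed.

Let Dp := pochX q (q ^- M) M.

Lemma den_coef0 : Dp`_0 = 1.
Proof.
rewrite -horner_coef0 horner_pochX big1 // => s _.
by rewrite mulr0 subr0.
Qed.

Lemma gen_Dy : Dp.[y] != 0.
Proof.
rewrite horner_pochX; apply/prodf_neq0 => s _; rewrite subr_eq0 eq_sym.
have := gen_neq1Q (s%:Z + (m + 2)%N%:Z - (n + m)%N%:Z) (-1) 0.
rewrite !expr0z !mulr1 exprN1 !expfzDr // -exprnN; apply: contra => /eqP e.
by apply/eqP; rewrite -[RHS]e -!exprnP /y; field; rewrite gen_d10 expf_neq0.
Qed.

Let rs (j k : 'I_M.+1) : nat -> F := r_coef q d1 d4 m n (idx j) (idx k).
Definition rvalue (j k : 'I_M.+1) : F := Rval q m n d1 d4 y j k / Dp.[y].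

Lemma rtildeE j k : rtilde q d1 d4 m n (idx j) (idx k) Q = rvalue j k.
Proof.
apply: rational_evalE; exists (Rmx q m n d1 d4 j k), Dp; split => //.
- exact: gen_Dy.
- by move=> N; rewrite r_coefE //; exact: gen_hq.
- by rewrite horner_Rmx.
Qed.

Lemma psmul_den_r_coef j k : psmul (fun N => Dp`_N) (rs j k) = fun N => (Rmx q m n d1 d4 j k)`_N.
Proof.
apply: functional_extensionality => N; apply: r_coefE => //; exact: gen_hq.
Qed.

(** [Rmx_comm] at c y = Q, divided by the denominators at y and at Lambda; the latter is cancelled
    as a series with constant term 1. *)
Lemma r_coef_comm (l k : 'I_M.+1) :
  (fun N => \sum_(j < M.+1) (Q ^+ l * c ^+ j * rvalue j k) * psshift j (rs l j) N) =
  (fun N => \sum_(j < M.+1) (c ^+ l * rvalue l j * Q ^+ j) * psshift l (rs j k) N).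
Proof.
apply: (@psmul_inj _ (fun N => Dp`_N)); first by rewrite den_coef0 oner_neq0.
rewrite !psmul_sumr; apply: functional_extensionality => N.
have cy : c * y = Q by rewrite /c /y; field; rewrite gen_d10 expf_neq0.
have := Rmx_comm gen_q0 gen_hq l k gen_y0 gen_s; rewrite -/c cy.
move/(congr1 (fun p : {poly F} => p`_N / Dp.[y])); rewrite !coef_sum !mulr_suml => e.
transitivity (\sum_(j < M.+1)
    ((Q ^+ l * c ^+ j * Rval q m n d1 d4 y j k) *: ('X^j * Rmx q m n d1 d4 l j))`_N / Dp.[y]).
  apply: eq_bigr => j _.
  rewrite psmul_shiftr psmul_den_r_coef coefZ coefXnM /psshift /rvalue leqNgt.
  by case: (ltnP N j) => _ /=; rewrite ?mulr0 ?mul0r //; ring.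
rewrite e; apply: eq_bigr => j _.
rewrite psmul_shiftr psmul_den_r_coef coefZ coefXnM /psshift /rvalue.
rewrite [(l <= N)%N]leqNgt.
by case: (ltnP N l) => _ /=; rewrite ?mulr0 ?mul0r //; ring.
Qed.


Lemma generic_div : generic q t d1 d4 (Q / t).
Proof.
case: gen => -[? ? ? ? ?] hg; split; first by split=> //; rewrite mulf_neq0 ?invr_eq0.
move=> a b c' d e he; case: (hg a (b - e) c' d e) => [|-> hb -> -> he0].
  by rewrite -[RHS]he expfzDr // expfzMl exprz_inv; ring.
by rewrite he0 subr0 in hb; rewrite hb he0.
Qed.

Lemma generic_qX (k : nat) : generic q t d1 d4 (q ^+ k * Q).
Proof.
case: gen => -[? ? ? ? ?] hg; split; first by split=> //; rewrite mulf_neq0 ?expf_neq0.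
move=> a b c' d e he; case: (hg (a + k%:Z * e) b c' d e) => [|ha -> -> -> he0].
  by rewrite -[RHS]he expfzDr // expfzMl -exprz_exp -exprnP; ring.
by rewrite he0 mulr0 addr0 in ha; rewrite ha he0.
Qed.

Variable Y : F -> 'I_M.+1 -> 'I_M.+1 -> nat -> F.
Hypothesis hY : forall Q : F, generic q t d1 d4 Q ->
  normalized_fundamental_solution q t d1 d4 Q (Y Q).

Lemma Y_rec Q' (k j : 'I_M.+1) : generic q t d1 d4 Q' -> Y Q' k j =
  fun N => \sum_(i < M.+1) (Q' ^- k * q ^ (- (idx k * (idx k + 1))) * Q' ^+ i) *
    psmul (psdil t^-1 (Y Q' k i)) (rs i j) N.
Proof.
move=> g'; have Q'0 : Q' != 0 by case: g' => -[].
case: (hY g') => _ _ h; apply: functional_extensionality => N; rewrite h.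
apply: eq_bigr => i _; congr (_ * _).
have -> : Q' ^ (- idx k) = Q' ^+ n * Q' ^- k by rewrite /idx opprB expfzDr // -exprnN.
have -> : Q' ^ idx i = Q' ^+ i * Q' ^- n by rewrite /idx expfzDr // -exprnN.
by field; rewrite !expf_neq0.
Qed.

(* c^n times the left-hand side of the proposition, with the exponents of Lambda
   shifted by n. *)
Definition Xser (i k : 'I_M.+1) (N : nat) : F :=
  \sum_(j < M.+1) (c ^+ j * rvalue j k) * psshift j (Y (Q / t) i j) N.

(** In the recursion for Lambda^i Y_i the power t^i compensates (Lambda/t)^i; in the one for X it
    comes from (Q/t)^-i. *)
Definition rec_scal (i : 'I_M.+1) : F := t ^+ i * Q ^- i * q ^ (- (idx i * (idx i + 1))).

(** Insert the recursion for Y at Q/t and exchange r(Lambda) with r(y) by [r_coef_comm]. The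
    leftover (Q/t)^l / Q^l = t^-l turns Lambda^l into (Lambda/t)^l. *)
Lemma Xser_rec (i k : 'I_M.+1) N :
  Xser i k N = \sum_(j < M.+1) (rec_scal i * Q ^+ j) *
    psmul (psdil t^-1 (Xser i j)) (rs j k) N.
Proof.
pose K := (Q / t) ^- i * q ^ (- (idx i * (idx i + 1))).
pose Yd l := psdil t^-1 (Y (Q / t) i l).
transitivity (\sum_(l < M.+1) (K * (Q / t) ^+ l / Q ^+ l) *
   psmul (Yd l) (fun N => \sum_(j < M.+1) (Q ^+ l * c ^+ j * rvalue j k) * psshift j (rs l j) N) N).
  transitivity (\sum_(j < M.+1) (c ^+ j * rvalue j k) * \sum_(l < M.+1) (K * (Q / t) ^+ l) *
     psmul (Yd l) (psshift j (rs l j)) N).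
    apply: eq_bigr => j _; congr (_ * _).
    rewrite (Y_rec i j generic_div) psshift_sum; apply: eq_bigr => l _; congr (_ * _).
    by rewrite psmul_shiftr.
  under eq_bigr => j _ do rewrite mulr_sumr.
  rewrite exchange_big; apply: eq_bigr => l _ /=.
  rewrite psmul_sumr mulr_sumr; apply: eq_bigr => j _.
  by field; rewrite expf_neq0.
under eq_bigr => l _ do rewrite r_coef_comm psmul_sumr mulr_sumr.
rewrite exchange_big; apply: eq_bigr => j _ /=.
rewrite psdil_sum psmul_suml mulr_sumr; apply: eq_bigr => l _.
rewrite psmul_shiftr psdil_shift psmulZl psmul_shiftl /rec_scal /K !expr_div_n exprVn.
by field; rewrite !expf_neq0.
Qed.

Lemma Yser_rec (i k : 'I_M.+1) N :
  psshift i (Y Q i k) N = \sum_(j < M.+1) (rec_scal i * Q ^+ j) *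
    psmul (psdil t^-1 (psshift i (Y Q i j))) (rs j k) N.
Proof.
rewrite {1}(Y_rec i k gen) psshift_sum; apply: eq_bigr => j _.
rewrite psdil_shift psmulZl psmul_shiftl /rec_scal exprVn.
by field; rewrite !expf_neq0.
Qed.

Lemma r_coef0_lower (j k : 'I_M.+1) : (k < j)%N -> rs j k 0 = 0.
Proof.
rewrite /rs /r_coef /idx => lt; case e: (_ - _ + _) => [a|a] //.
by exfalso; lia.
Qed.

Lemma r_coef0 (j k : 'I_M.+1) : rs j k 0 = (Rmx q m n d1 d4 j k)`_0.
Proof.
have := congr1 (fun f => f 0%N) (psmul_den_r_coef j k).
by rewrite /psmul big_ord1 den_coef0 mul1r.
Qed.

Lemma xpoly_coef0 al k : (xpoly q al k)`_0 = 1.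
Proof.
rewrite -horner_coef0 horner_pochX big1 // => s _.
by rewrite mulr0 subr0.
Qed.

Lemma Bentry_coef0 al be a b : (Bentry q m n al be a b)`_0 =
  if (a <= b)%N then q ^ triang (a%:Z - n%:Z) * (xpoly q al (M - a))`_(b - a) else 0.
Proof. by rewrite coef_Bentry addn0 xpoly_coef0 mulr1. Qed.

Lemma r_coef0_diag (k : 'I_M.+1) : rs k k 0 = q ^ (idx k * (idx k + 1)).
Proof.
rewrite r_coef0 mxE coef_sum (bigD1 k) //= big1 => [|b ne].
  rewrite !mxE addr0 coef0M !Bentry_coef0 leqnn subnn !xpoly_coef0 !mulr1.
  by rewrite -expfzDr // -/(idx k) -triang2; congr (q ^ _); ring.
rewrite !mxE coef0M !Bentry_coef0.
case: (ltngtP k b) => [lt|lt|e]; rewrite ?mulr0 ?mul0r //.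
by case/eqP: ne; apply: val_inj.
Qed.

(** Induction on the order N, then on the column k. As r(0) is upper triangular, the coefficient w_k
    at order N is multiplied by a power of q times t^(i-N) Q^(k-i) and must reproduce itself.
    Genericity forces it to vanish unless k = i and N = i, the one coefficient assumed to be
    zero. *)
Lemma rec_unique (i : 'I_M.+1) (w : 'I_M.+1 -> nat -> F) :
  (forall k N, w k N = \sum_(j < M.+1) (rec_scal i * Q ^+ j) *
     psmul (psdil t^-1 (w j)) (rs j k) N) ->
  w i i = 0 -> forall N k, w k N = 0.
Proof.
move=> hw wi0; elim/ltn_ind => N IHN.
suff H : forall K (k : 'I_M.+1), (k < K)%N -> w k N = 0 by move=> k; apply: (H k.+1).
elim=> // K IHK k; rewrite ltnS => leK.
have term j : psmul (psdil t^-1 (w j)) (rs j k) N = t^-1 ^+ N * w j N * rs j k 0.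
  rewrite /psmul big_ord_recr /= subnn big1 ?add0r // => s _.
  by rewrite /psdil IHN ?mulr0 ?mul0r.
have e : w k N = rec_scal i * Q ^+ k * (t^-1 ^+ N * w k N * q ^ (idx k * (idx k + 1))).
  rewrite {1}hw (bigD1 k) //= term r_coef0_diag big1 ?addr0 // => j ne; rewrite term.
  case: (ltngtP j k) => [lt|lt|e]; last by case/eqP: ne; apply: val_inj.
    by rewrite IHK ?mulr0 ?mul0r ?mulr0 // (leq_trans lt).
  by rewrite r_coef0_lower ?mulr0.
case: (boolP ((k == i) && (N == i :> nat))) => [/andP[/eqP-> /eqP->]|ne] //.
apply/eqP; apply: contraNT ne => w0.
have : rec_scal i * Q ^+ k * (t^-1 ^+ N * q ^ (idx k * (idx k + 1))) = 1.
  by apply: (mulIf w0); rewrite mul1r {2}e; ring.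
have -> : rec_scal i * Q ^+ k * (t^-1 ^+ N * q ^ (idx k * (idx k + 1))) =
   q ^ (idx k * (idx k + 1) - idx i * (idx i + 1)) * t ^ (i%:Z - N%:Z) * d1 ^ 0 * d4 ^ 0 *
   Q ^ (k%:Z - i%:Z).
  rewrite !expr0z !mulr1 !expfzDr // -!exprnN -!exprnP /rec_scal exprVn.
  by ring.
case: gen => _ hg /hg [_ e1 _ _ e2].
by apply/andP; split; [apply/eqP/val_inj => /=|apply/eqP]; lia.
Qed.

(** The constant is read off at Lambda^i in column i, where Lambda^i Y_ii has coefficient 1; the
    difference of the two solutions then vanishes by [rec_unique]. *)
Lemma Xser_Y (i k : 'I_M.+1) N : Xser i k N = Xser i i i * psshift i (Y Q i k) N.
Proof.
set C := Xser i i i.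
pose w k N := Xser i k N - C * psshift i (Y Q i k) N.
apply/eqP; rewrite -subr_eq0 -/(w k N); apply/eqP.
move: N k; apply: (@rec_unique i) => [k N|].
  rewrite /w Xser_rec Yser_rec mulr_sumr -sumrB; apply: eq_bigr => j _.
  rewrite mulrCA -mulrBr; congr (_ * _); rewrite /psmul mulr_sumr -sumrB.
  by apply: eq_bigr => s _; rewrite /psdil; ring.
rewrite /w /psshift leqnn subnn; case: (hY gen) => _ -> _.
by rewrite mulr1 subrr.
Qed.

End Solution.

(** * The connection coefficients *)
Section Unitriangular.
Variables (F : fieldType) (M : nat).
Implicit Types A B : 'M[F]_M.+1.

Definition lower1 A := (forall i j : 'I_M.+1, (i < j)%N -> A i j = 0) /\ (forall i, A i i = 1).
Definition upper1 A := (forall i j : 'I_M.+1, (j < i)%N -> A i j = 0) /\ (forall i, A i i = 1).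

Lemma lower1_inv A : lower1 A -> exists B, [/\ B *m A = 1%:M, A *m B = 1%:M & lower1 B].
Proof.
case=> [Al A1]; have uA : A \in unitmx.
  rewrite unitmxE det_trig; last exact/is_trig_mxP.
  by rewrite big1 ?unitr1 // => i _; rewrite A1.
exists (invmx A); split; [exact: mulVmx | exact: mulmxV |].
have AV := mulmxV uA; set B := invmx A in AV *.
have Bl (i j : 'I_M.+1) : (i < j)%N -> B i j = 0.
  have [k] := ubnP i; elim: k i j => // k IH i j lek lt.
  have := congr1 (fun C : 'M_M.+1 => C i j) AV; rewrite !mxE (bigD1 i) //= A1 mul1r.
  rewrite big1 ?addr0 => [->|l ne]; last first.
    case: (ltngtP l i) => [li|il|e]; last by case/eqP: ne; apply: val_inj.
      by rewrite IH ?mulr0 //; [exact: leq_trans li lek | exact: ltn_trans li lt].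
    by rewrite Al ?mul0r.
  by rewrite (_ : (i == j) = false) //; apply/negbTE; apply: contraTneq lt => ->; rewrite ltnn.
split=> // i; have := congr1 (fun C : 'M_M.+1 => C i i) AV.
rewrite !mxE eqxx (bigD1 i) //= A1 mul1r big1 ?addr0 // => l ne.
case: (ltngtP l i) => [li|il|e]; last by case/eqP: ne; apply: val_inj.
  by rewrite Bl ?mulr0.
by rewrite Al ?mul0r.
Qed.

Lemma upper1_inv A : upper1 A -> exists B, [/\ B *m A = 1%:M, A *m B = 1%:M & upper1 B].
Proof.
case=> Au A1; have [|B [h1 h2 [Bl B1]]] := @lower1_inv A^T.
  by split=> *; rewrite mxE ?A1 // Au.
exists B^T; split.
- by rewrite -[A]trmxK -trmx_mul h2 trmx1.
- by rewrite -[A]trmxK -trmx_mul h1 trmx1.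
- by split=> *; rewrite mxE ?B1 // Bl.
Qed.

Lemma lower1_diag_mul A B (d : 'I_M.+1 -> F) i : lower1 A -> lower1 B ->
  \sum_l A i l * d l * B l i = d i.
Proof.
move=> [Al A1] [Bl B1]; rewrite (bigD1 i) //= A1 B1 mul1r mulr1 big1 ?addr0 // => l ne.
case: (ltngtP l i) => [li|il|e]; last by case/eqP: ne; apply: val_inj.
  by rewrite Bl ?mulr0.
by rewrite Al ?mul0r.
Qed.

Lemma upper1_inv_super A B (i j : 'I_M.+1) : A *m B = 1%:M -> upper1 A -> upper1 B ->
  j = i.+1 :> nat -> B i j = - A i j.
Proof.
move=> AB [Au A1] [Bu B1] e; have ne : i != j by apply/eqP => e'; move: e; rewrite e'; lia.
have := congr1 (fun C : 'M_M.+1 => C i j) AB; rewrite !mxE (negPf ne).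
rewrite (bigD1 i) //= (bigD1 j) 1?eq_sym //= A1 B1 mul1r mulr1 big1 ?addr0 => [|l /andP[n1 n2]].
  by move/eqP; rewrite addr_eq0 => /eqP.
have [li|il] := ltnP l i; first by rewrite Au ?mul0r.
rewrite Bu ?mulr0 // e; have : l != i :> nat by [].
by have : l != j :> nat by []; rewrite e; lia.
Qed.

End Unitriangular.

(** * Leading minors of triangular products *)

Section LeadingMinors.
Variables (K : comNzRingType) (M : nat).
Implicit Types A B : 'M[K]_M.+1.

Definition lead_mx k A : 'M[K]_k := \matrix_(a, b) A (inord a) (inord b).

Lemma inord_val_lt k (a : 'I_k) : (k <= M.+1)%N -> (inord a : 'I_M.+1) = a :> nat.
Proof. by move=> le; rewrite inordK // (leq_trans (ltn_ord a)). Qed.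

Lemma sum_lead k (f : 'I_M.+1 -> K) : (k <= M.+1)%N ->
  (forall j : 'I_M.+1, (k <= j)%N -> f j = 0) -> \sum_j f j = \sum_(j < k) f (inord j).
Proof.
move=> le f0; pose g (j : nat) := f (inord j).
transitivity (\sum_(j < M.+1) g j); first by apply: eq_bigr => j _; rewrite /g inord_val.
rewrite (big_ord_widen _ g le) [RHS]big_mkcond; apply: eq_bigr => j _.
by case: ltnP => // /f0; rewrite /g inord_val.
Qed.

(** Indices outside the leading block do not contribute when the left factor is lower triangular; in
    [lead_mul_upper] the same holds when the right factor is upper triangular. *)
Lemma lead_mul_lower k A B : (k <= M.+1)%N -> (forall i j : 'I_M.+1, (i < j)%N -> A i j = 0) ->
  lead_mx k (A *m B) = lead_mx k A *m lead_mx k B.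
Proof.
move=> le Al; apply/matrixP => a b; rewrite !mxE (sum_lead le) => [|j lej].
  by apply: eq_bigr => j _; rewrite !mxE.
by rewrite Al ?mul0r // inord_val_lt // (leq_trans _ lej).
Qed.

Lemma lead_mul_upper k A B : (k <= M.+1)%N -> (forall i j : 'I_M.+1, (j < i)%N -> B i j = 0) ->
  lead_mx k (A *m B) = lead_mx k A *m lead_mx k B.
Proof.
move=> le Bu; apply/matrixP => a b; rewrite !mxE (sum_lead le) => [|j lej].
  by apply: eq_bigr => j _; rewrite !mxE.
by rewrite Bu ?mulr0 // inord_val_lt // (leq_trans _ lej).
Qed.

Lemma det_lead_lower k A : (k <= M.+1)%N -> (forall i j : 'I_M.+1, (i < j)%N -> A i j = 0) ->
  \det (lead_mx k A) = \prod_(j < k) A (inord j) (inord j).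
Proof.
move=> le Al; rewrite det_trig; last first.
  by apply/is_trig_mxP => a b ab; rewrite mxE Al // !inord_val_lt.
by apply: eq_bigr => j _; rewrite mxE.
Qed.

Lemma det_lead_upper k A : (k <= M.+1)%N -> (forall i j : 'I_M.+1, (j < i)%N -> A i j = 0) ->
  \det (lead_mx k A) = \prod_(j < k) A (inord j) (inord j).
Proof.
move=> le Au; rewrite -det_tr det_trig; last first.
  by apply/is_trig_mxP => a b ab; rewrite !mxE Au // !inord_val_lt.
by apply: eq_bigr => j _; rewrite !mxE.
Qed.

End LeadingMinors.

(** * Triangular factorization of r(y) and the step from Q to q Q *)

Section Connection.
Variables (F : fieldType) (m n : nat) (q t d1 d4 : F).
Local Notation M := (n + m)%N.
Variable Y : F -> 'I_M.+1 -> 'I_M.+1 -> nat -> F.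
Hypothesis hY : forall Q : F, generic q t d1 d4 Q ->
  normalized_fundamental_solution q t d1 d4 Q (Y Q).
Let c := d1 / q ^+ (m + 2).
Let Dp := pochX q (q ^- M) M.
Let yof (Q : F) := q ^+ (m + 2) / d1 * Q.

Definition Umx Q : 'M[F]_M.+1 := \matrix_(i, k) Y Q i k 0%N.
(** Entry (i, j) is the coefficient of Lambda^i in Lambda^j Y_ij(Lambda, Q/t), that is, its
    contribution to row i of X at order i. *)
Definition Wmx Q : 'M[F]_M.+1 :=
  \matrix_(i, j) (if (j <= i)%N then Y (Q / t) i j (i - j)%N else 0).
Definition Cval Q (i : 'I_M.+1) : F := Xser q t d1 d4 Q Y i i i.
(** Closed form of the superdiagonal entry of Y(0, Q) in row a; see [Umx_super]. *)
Definition uval Q (a : nat) : F :=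
  q * (1 - q ^+ a / q ^+ M) * (1 - d1 * (q ^+ a / q ^+ n)) /
  ((1 - q) * (1 - Q * q ^+ 2 * (q ^+ a / q ^+ n) ^+ 2)).

Lemma coef1_pochX b r : (pochX q b r)`_1 * (1 - q) = b * (q ^+ r - 1).
Proof.
elim: r => [|r IH]; first by rewrite /pochX big_ord0 coef1 expr0 subrr mul0r mulr0.
rewrite pochXSr mulrBl mul1r coefB -mulrA coefCM coefXM /= mulrBl IH.
rewrite -horner_coef0 horner_pochX big1 => [|s _]; last by rewrite mulr0 subr0.
by rewrite exprS; ring.
Qed.

Section FixQ.
Variable Q : F.
Hypothesis gen : generic q t d1 d4 Q.
Let q0 := gen_q0 gen.
Let hq := gen_hq gen.
Let Q0 := gen_Q0 gen.

Lemma Umx_upper1 : upper1 (Umx Q).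
Proof.
case: (hY gen) => h1 h2 _; split=> [i j lt|i]; rewrite mxE; [exact: h1 | exact: h2].
Qed.

Lemma Wmx_lower1 : lower1 (Wmx Q).
Proof.
case: (hY (generic_div gen)) => h1 h2 _; split=> [i j lt|i]; rewrite mxE.
  by rewrite leqNgt lt.
by rewrite leqnn subnn h2.
Qed.

(** The coefficient of Lambda^i in row i of [Xser_Y]: a factorization of R(y) into lower
    unitriangular, diagonal and upper unitriangular parts. *)
Lemma connection :
  Wmx Q *m (powdiag m n c *m Rval q m n d1 d4 (yof Q)) =
  Dp.[yof Q] *: \matrix_(i, k) (Cval Q i * Umx Q i k).
Proof.
have D0 : Dp.[yof Q] != 0 by exact: (gen_Dy m n gen).
apply/matrixP => i k; rewrite 2!mxE.
have := Xser_Y gen hY i k i; rewrite /psshift leqnn subnn -/(Cval Q i).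
rewrite !mxE => <-; rewrite /Xser mulr_sumr; apply: eq_bigr => j _.
rewrite mul_powdiag mxE /psshift /rvalue; case: ifP => _; last by rewrite mul0r !mulr0.
by rewrite -/c -/Dp -/(yof Q); field.
Qed.

Lemma gen_1q : 1 - q != 0.
Proof. by rewrite subr_eq0 eq_sym -[q]expr1 hq. Qed.

Lemma gen_1Q (a : nat) (b : int) : 1 - q ^ b * Q != 0.
Proof.
rewrite subr_eq0 eq_sym; have := gen_neq1Q gen b 0 0.
by rewrite !expr0z !mulr1.
Qed.

(** At Lambda = 0 the recursion for the entry (i, i+1) involves only this entry and the diagonal
    one, because Y(0, Q) and r(0) are upper triangular. *)
Lemma Umx_super (i k : 'I_M.+1) : k = i.+1 :> nat -> Umx Q i k = uval Q i.
Proof.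
move=> e; have ne : k != i by apply/eqP => e'; move: e; rewrite e'; lia.
have [Ul U1] := Umx_upper1.
have h : Umx Q i k * (1 - Q * q ^+ 2 * (q ^+ i / q ^+ n) ^+ 2) =
    q ^ (- (idx i * (idx i + 1))) * (Rmx q m n d1 d4 i k)`_0.
  have := congr1 (fun f => f 0%N) (Y_rec hY i k gen).
  have term (l : 'I_M.+1) : psmul (psdil t^-1 (Y Q i l))
      (r_coef q d1 d4 m n (idx l) (idx k)) 0 = Umx Q i l * r_coef q d1 d4 m n (idx l) (idx k) 0.
    by rewrite /psmul big_ord1 /psdil expr0 mul1r mxE.
  rewrite (bigD1 i) //= (bigD1 k) //= !term U1 mul1r big1 ?addr0 => [|l /andP[n1 n2]]; last first.
    rewrite term; have [li|il] := ltnP l i; first by rewrite Ul ?mul0r ?mulr0.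
    rewrite r_coef0_lower ?mulr0 //.
    have : l != i :> nat by []. have : l != k :> nat by [].
    by rewrite e; lia.
  rewrite (r_coef0 gen) (r_coef0_diag gen) => h.
  have hU : Y Q i k 0%N = Umx Q i k by rewrite mxE.
  rewrite hU in h.
  have -> : Umx Q i k * (1 - Q * q ^+ 2 * (q ^+ i / q ^+ n) ^+ 2) = Umx Q i k -
      Q ^- i * q ^ (- (idx i * (idx i + 1))) * Q ^+ k * (Umx Q i k * q ^ (idx k * (idx k + 1))).
    have -> : q ^ (idx k * (idx k + 1)) =
        q ^ (idx i * (idx i + 1)) * (q ^+ 2 * (q ^+ i / q ^+ n) ^+ 2).
      rewrite (_ : q ^+ i / q ^+ n = q ^ idx i); last by rewrite /idx expfzDr // -exprnN.
      rewrite (exprnP q 2) exprnP exprz_exp -!expfzDr //; congr (q ^ _).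
      by rewrite (_ : idx k = idx i + 1) ?/idx ?e; [ring|lia].
    rewrite e (exprS Q); have qi0 : q ^ (idx i * (idx i + 1)) != 0 by rewrite expfz_neq0.
    have -> : q ^ (- (idx i * (idx i + 1))) = (q ^ (idx i * (idx i + 1)))^-1 by rewrite invr_expz.
    by move: (q ^ _) qi0 => T T0; field; rewrite T0 !expf_neq0.
  rewrite [X in X - _ = _]h addrK; field.
  by rewrite expf_neq0.
have den : 1 - Q * q ^+ 2 * (q ^+ i / q ^+ n) ^+ 2 != 0.
  have := gen_1Q 0 (2 + idx i * 2); apply: contraNneq => e0; apply/eqP; rewrite -[RHS]e0.
  congr (1 - _); rewrite expfzDr // -exprz_exp -!exprnP /idx expfzDr // -exprnN.
  by rewrite -exprnP; ring.
apply: (mulIf den); rewrite h /uval.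
have iM : (i < M)%N by have := ltn_ord k; rewrite e.
rewrite mxE coef_sum (bigD1 i) //= (bigD1 k) //= big1 ?addr0 => [|l /andP[n1 n2]]; last first.
  rewrite !mxE coef0M !Bentry_coef0.
  case: (leqP i l) => il; last by rewrite mul0r.
  case: (leqP l k) => lk; last by rewrite mulr0.
  have : l != i :> nat by []. have : l != k :> nat by [].
  by move: il lk; rewrite e; lia.
rewrite !mxE !coef0M !Bentry_coef0 !leqnn !subnn !xpoly_coef0 e leqnSn.
rewrite (_ : (i.+1 - i = 1)%N); last by lia.
rewrite (triang_step _ q0) -/(idx i).
have c1 al : (xpoly q al (M - i))`_1 = al * (1 - q ^+ i / q ^+ M) / (1 - q).
  apply: (mulIf gen_1q); rewrite divfK ?gen_1q // coef1_pochX.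
  have -> : q ^+ M = q ^+ i * q ^+ (M - i) by rewrite -exprD subnKC // ltnW.
  by field; rewrite !expf_neq0.
rewrite !c1 exprS.
have -> : q ^ (- (idx i * (idx i + 1))) = (q ^ triang (idx i))^-1 * (q ^ triang (idx i))^-1.
  rewrite -triang2 invr_expz -expfzDr //; congr (q ^ _); ring.
have T0 : q ^ triang (idx i) != 0 by rewrite expfz_neq0.
move: den; move: (q ^ triang (idx i)) T0 => T T0 den.
have den' : (q ^+ n) ^+ 2 - Q * q ^+ 2 * (q ^+ i) ^+ 2 != 0.
  apply: contraNneq den => e0; apply/eqP; apply: (@mulIf _ ((q ^+ n) ^+ 2)).
    by rewrite !expf_neq0.
  by rewrite mul0r -[RHS]e0; field; rewrite expf_neq0.
by field; rewrite T0 den' gen_1q !expf_neq0.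
Qed.

Lemma yof_q : yof (q * Q) = q * yof Q.
Proof. by rewrite /yof mulrCA. Qed.

Lemma generic_q : generic q t d1 d4 (q * Q).
Proof. by have := generic_qX gen 1; rewrite expr1. Qed.

End FixQ.

(** This is q^i times the i-th diagonal entry of U(Q) Ph(y) S^-1 U(q Q)^-1. As Ph is tridiagonal,
    only the superdiagonals of the unitriangular factors enter; boundary terms drop out since [ph_m]
    is 0 at row 0 and [uval] is 0 at row M. *)
Definition theta Q (a : nat) : F :=
  pm_0 q m n d1 d4 (yof Q) a + uval Q a * ph_m q m n d1 d4 (yof Q) a.+1 -
  q * uval (q * Q) a.-1 * ph_m q m n d1 d4 (yof Q) a.

Definition step_scal Q : F := Rscal1 q m n (yof Q) * Rscal2 q m n d1 d4 (yof Q) * Dp.[yof (q * Q)].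

(** The factorizations at Q and q Q are put into [Rval_conj_shift]. With the upper factors moved to
    the right, the left side is lower triangular with diagonal q^-i C_i(q Q) up to [step_scal];
    comparing diagonals suffices. *)
Lemma Cval_step Q (i : 'I_M.+1) : generic q t d1 d4 Q ->
  step_scal Q * Cval (q * Q) i = Dp.[yof Q] * Cval Q i * theta Q i.
Proof.
move=> gen; have gen' := generic_q gen.
have q0 := gen_q0 gen; have hq := gen_hq gen.
have [Wi [WiW _ Wil]] := lower1_inv (Wmx_lower1 gen').
have [Z [_ UZ Zu]] := upper1_inv (Umx_upper1 gen').
pose Cd Q' : 'M[F]_M.+1 := diag_mx (\row_a Cval Q' a).
have CdE Q' : \matrix_(j, k) (Cval Q' j * Umx Q' j k) = Cd Q' *m Umx Q'.
  by apply/matrixP => a b; rewrite mul_diag_mx !mxE.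
have con := connection gen; have con' := connection gen'.
rewrite !CdE yof_q in con con'.
pose Si := powdiag m n q^-1.
have SiS : Si *m qdiag q m n = 1%:M.
  rewrite [LHS]powdiagM mulVf //; apply/matrixP => a b; rewrite !mxE.
  by rewrite expr1n.
have SSi : qdiag q m n *m Si = 1%:M by rewrite [LHS]powdiagC.
have main : (step_scal Q *: (Wmx Q *m Si *m Wi *m Cd (q * Q))) =
    Dp.[yof Q] *: (Cd Q *m (Umx Q *m (Phmx q m n d1 d4 (yof Q) *m (Si *m Z)))).
  have eR : powdiag m n c *m Rval q m n d1 d4 (q * yof Q) =
      Dp.[q * yof Q] *: (Wi *m (Cd (q * Q) *m Umx (q * Q))).
    by rewrite scalemxAr -con' !mulmxA WiW mul1mx.
  have := Rval_conj_shift m n d1 d4 q0 hq (yof Q).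
  move/(congr1 (fun A => Wmx Q *m Si *m (powdiag m n c *m A) *m (Si *m Z))).
  have -> : Wmx Q *m Si *m (powdiag m n c *m (qdiag q m n *m Rval q m n d1 d4 (yof Q) *m
      Phmx q m n d1 d4 (yof Q))) *m (Si *m Z) =
      Dp.[yof Q] *: (Cd Q *m (Umx Q *m (Phmx q m n d1 d4 (yof Q) *m (Si *m Z)))).
    rewrite -!mulmxA [powdiag m n c *m (qdiag _ _ _ *m _)]mulmxA.
    rewrite [powdiag m n c *m qdiag q m n]powdiagC -!mulmxA.
    rewrite [Si *m (powdiag _ _ _ *m _)]mulmxA [Si *m powdiag _ _ _](_ : _ = 1%:M) ?mul1mx //.
    rewrite !mulmxA -[Wmx Q *m _ *m _]mulmxA con -!scalemxAl.
    by rewrite -!mulmxA.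
  have -> : Wmx Q *m Si *m (powdiag m n c *m ((Rscal1 q m n (yof Q) * Rscal2 q m n d1 d4 (yof Q)) *:
      (Rval q m n d1 d4 (q * yof Q) *m qdiag q m n))) *m (Si *m Z) =
      step_scal Q *: (Wmx Q *m Si *m Wi *m Cd (q * Q)).
    rewrite -!scalemxAr -scalemxAl [powdiag m n c *m _]mulmxA eR.
    rewrite -!scalemxAl -!scalemxAr -!scalemxAl scalerA.
    rewrite /step_scal yof_q; congr (_ *: _); rewrite -!mulmxA.
    by rewrite [qdiag _ _ _ *m (Si *m Z)]mulmxA SSi mul1mx UZ mulmx1.
  by [].
have := congr1 (fun A : 'M_M.+1 => A i i) main.
have [Wl W1] := Wmx_lower1 gen; have [Zl Z1] := Zu; have [Ul U1] := Umx_upper1 gen.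
have hL : (Wmx Q *m Si *m Wi) i i = q^-1 ^+ i.
  rewrite mxE -(lower1_diag_mul (fun l : 'I_M.+1 => q^-1 ^+ l) i (Wmx_lower1 gen) Wil).
  by apply: eq_bigr => l _; congr (_ * _); rewrite /Si /powdiag mul_mx_diag !mxE.
(* Column i of S^-1 U(q Q)^-1 as a function on naturals, as [trimx_sum] needs; it vanishes strictly
   below row i. *)
pose f k := q^-1 ^+ k * Z (inord k) i.
have fE (k : 'I_M.+1) : (Si *m Z) k i = f k by rewrite /Si mul_powdiag /f inord_val.
have f0 (k : nat) : (i < k)%N -> (k <= M)%N -> f k = 0.
  by move=> ik kM; rewrite /f Zl ?mulr0 // inordK.
have fi : f i = q^-1 ^+ i by rewrite /f inord_val Z1 mulr1.
have hR : (Umx Q *m (Phmx q m n d1 d4 (yof Q) *m (Si *m Z))) i i =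
    q^-1 ^+ i * theta Q i.
  have PhE (l : 'I_M.+1) : (Phmx q m n d1 d4 (yof Q) *m (Si *m Z)) l i =
     ph_m q m n d1 d4 (yof Q) l * f l.-1 + pm_0 q m n d1 d4 (yof Q) l * f l +
     ph_p q m n d1 l * f l.+1.
    rewrite mxE; under eq_bigr => k _ do rewrite fE.
    apply: trimx_sum; first by rewrite /ph_m om_m0 mulr0.
    by rewrite /ph_p qm_zzM // subrr mulr0 mul0r.
  rewrite mxE; under eq_bigr => l _ do rewrite PhE.
  have liM : (i <= M)%N by rewrite -ltnS.
  have fpred : ph_m q m n d1 d4 (yof Q) i * f i.-1 =
      - (q^-1 ^+ i * (q * uval (q * Q) i.-1 * ph_m q m n d1 d4 (yof Q) i)).
    case ei: (nat_of_ord i) => [|k]; first by rewrite /ph_m om_m0 !(mulr0, mul0r) oppr0.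
    rewrite /= /f (@upper1_inv_super _ _ _ _ (inord k) i UZ (Umx_upper1 gen') Zu); last first.
      by rewrite inordK ?ei // -ei ltnW // ltn_ord.
    rewrite (Umx_super gen'); last by rewrite inordK ?ei // -ei ltnW // ltn_ord.
    rewrite inordK; last by rewrite -ei ltnW // ltn_ord.
    by rewrite exprSr; field.
  have psucc : ph_p q m n d1 i * f i.+1 = 0.
    have [iM|Mi] := ltnP i M; first by rewrite f0 ?mulr0.
    rewrite (_ : nat_of_ord i = M); last by lia.
    by rewrite /ph_p qm_zzM // subrr mulr0 !mul0r.
  rewrite (bigD1 i) //= U1 mul1r psucc addr0 fpred fi.
  have [iM|Mi] := ltnP i M; last first.
    rewrite big1 ?addr0 => [|l ne].
      have u0 : uval Q i = 0.
        rewrite /uval (_ : nat_of_ord i = M); last by lia.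
        by rewrite divff ?expf_neq0 // subrr !(mulr0, mul0r).
      by rewrite /theta u0 mul0r addr0; ring.
    by rewrite Ul ?mul0r //; have : l != i :> nat by []; have := ltn_ord l; lia.
  pose i1 := Ordinal (iM : (i.+1 < M.+1)%N).
  have i1i : i1 != i by apply/eqP => /(congr1 (@nat_of_ord _)) /=; lia.
  rewrite (bigD1 i1) //= big1 ?addr0 => [|l /andP[n1 n2]]; last first.
    have [li|il] := ltnP l i; first by rewrite Ul ?mul0r.
    have a1 : l != i :> nat by []. have a2 : l != i.+1 :> nat by [].
    have lM : (l <= M)%N by rewrite -ltnS.
    rewrite (f0 l.-1) ?(f0 l) ?mulr0 ?add0r; try lia.
    have [lM'|Ml] := ltnP l M; first by rewrite (f0 l.+1) ?mulr0 //; lia.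
    rewrite (_ : nat_of_ord l = M); last by lia.
    by rewrite /ph_p qm_zzM // subrr mulr0 !mul0r mulr0.
  rewrite (Umx_super gen) //= fi (f0 i.+1) // mulr0 addr0.
  have -> : ph_p q m n d1 i.+1 * f i.+2 = 0.
    have [lM'|Ml] := ltnP i.+1 M; first by rewrite (f0 i.+2) ?mulr0 //; lia.
    rewrite (_ : i.+1 = M); last by lia.
    by rewrite /ph_p qm_zzM // subrr mulr0 !mul0r.
  by rewrite addr0 /theta; ring.
rewrite mxE /Cd mul_mx_diag [in RHS]mxE mul_diag_mx !mxE.
move=> e; apply: (@mulIf _ (q^-1 ^+ i)); first by rewrite expf_neq0 ?invr_eq0.
move: hL hR; rewrite !mxE => hL hR; move: e; rewrite hL hR => e.
transitivity (step_scal Q * (q^-1 ^+ i * Cval (q * Q) i)); first by ring.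
by rewrite e; ring.
Qed.

End Connection.

(** * Identification of C_i with v_i *)

Section Final.
Variables (F : fieldType) (m n : nat) (q t d1 d4 : F).
Local Notation M := (n + m)%N.
Variable Y : F -> 'I_M.+1 -> 'I_M.+1 -> nat -> F.
Hypothesis hY : forall Q : F, generic q t d1 d4 Q ->
  normalized_fundamental_solution q t d1 d4 Q (Y Q).
Let c := d1 / q ^+ (m + 2).
Let Dp := pochX q (q ^- M) M.
Let yof (Q : F) := q ^+ (m + 2) / d1 * Q.

Lemma qpoch_shift (x : F) k : qpoch (q * x) q k * (1 - x) = qpoch x q k * (1 - x * q ^+ k).
Proof.
elim: k => [|k IH]; first by rewrite /qpoch !big_ord0 expr0 mulr1.
rewrite /qpoch !big_ord_recr /= -/(qpoch _ q k) -/(qpoch x q k) mulrAC IH exprS.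
by ring.
Qed.

Lemma qpoch_shiftV (x : F) k : 1 - x != 0 ->
  qpoch (q * x) q k = qpoch x q k * (1 - x * q ^+ k) / (1 - x).
Proof. by move=> h; rewrite -qpoch_shift mulfK. Qed.

Lemma horner_pochX_qpoch (b x : F) k : (pochX q b k).[x] = qpoch (x * b) q k.
Proof.
by rewrite horner_pochX; apply: eq_bigr => s _; rewrite mulrAC [b * x]mulrC.
Qed.

(** [vcoefE] writes v_i as [vconst] times a quotient of polynomials in Q with constant term 1, so
    [vconst] is its value at Q = 0. *)
Definition vconst (i : 'I_M.+1) : F := q ^ (idx i * (idx i + 1)) * (c ^+ i / c ^+ n).
Definition vnum (i : 'I_M.+1) : {poly F} :=
  pochX q (q ^+ 2 * (q ^+ i / q ^+ n) ^+ 2) (M - i) * pochX q (d4 * q / q ^+ n) i.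
Definition vden (i : 'I_M.+1) : {poly F} :=
  pochX q (q ^+ 2 * (q ^+ i / q ^+ n) / d1) (M - i) *
  pochX q (q * (q ^+ i / q ^+ n) / q ^+ n) i.

Lemma vcoefE Q (i : 'I_M.+1) : generic q t d1 d4 Q ->
  vcoef q d1 d4 m n (idx i) Q = vconst i * (vnum i).[Q] / (vden i).[Q].
Proof.
move=> gen; have q0 := gen_q0 gen; have d10 := gen_d10 gen.
have iM : (i <= M)%N by rewrite -ltnS.
rewrite /vcoef /vconst /vnum /vden !hornerM !horner_pochX_qpoch.
have -> : absz (m%:Z - idx i) = (M - i)%N by rewrite /idx; lia.
have -> : absz (n%:Z + idx i) = i by rewrite /idx; lia.
have ci : c ^ idx i = c ^+ i / c ^+ n.
  have c0 : c != 0 by rewrite mulf_neq0 ?invr_eq0 ?expf_neq0.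
  by rewrite /idx expfzDr // -exprnN.
rewrite ci.
have zi : q ^ idx i = q ^+ i / q ^+ n by rewrite /idx expfzDr // -exprnN.
have z2 : q ^ (2 + 2 * idx i) = q ^+ 2 * (q ^+ i / q ^+ n) ^+ 2.
  by rewrite expfzDr // mulrC [2 * _]mulrC -exprz_exp zi mulrC.
have z1 : q ^ (1 - n%:Z) = q / q ^+ n by rewrite expfzDr // expr1z -exprnN.
rewrite z2 [q ^ (2 + _)]expfzDr // [q ^ (1 - _ + _)]expfzDr // z1 zi.
rewrite (_ : d4 * Q * (q / q ^+ n) = Q * (d4 * q / q ^+ n)); last by ring.
rewrite (_ : d1^-1 * Q * (q ^ 2 * (q ^+ i / q ^+ n)) =
  Q * (q ^+ 2 * (q ^+ i / q ^+ n) / d1)); last by rewrite -exprnP; ring.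
rewrite (_ : Q * (q / q ^+ n * (q ^+ i / q ^+ n)) =
  Q * (q * (q ^+ i / q ^+ n) / q ^+ n)); last by ring.
by rewrite mulrA.
Qed.

Lemma gen_neq0 Q (a b d : int) z : generic q t d1 d4 Q ->
  z = q ^ a * d1 ^ b * d4 ^ d -> 1 - Q * z != 0.
Proof. by move=> gen ->; rewrite subr_eq0 eq_sym mulrC (gen_neq1Q gen). Qed.

Lemma vden_neq0 Q (i : 'I_M.+1) : generic q t d1 d4 Q -> (vden i).[Q] != 0.
Proof.
move=> gen; have q0 := gen_q0 gen.
rewrite /vden hornerM mulf_neq0 // horner_pochX; apply/prodf_neq0 => s _; rewrite mulrC.
  apply: (gen_neq0 (a := 2 + i%:Z - n%:Z + s%:Z) (b := -1) (d := 0)) => //.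
  rewrite expr0z mulr1 exprN1 !expfzDr // -exprnN -!exprnP; ring.
apply: (gen_neq0 (a := 1 + i%:Z - n%:Z - n%:Z + s%:Z) (b := 0) (d := 0)) => //.
by rewrite !expr0z !mulr1 !expfzDr // -exprnN -!exprnP expr1; ring.
Qed.

Lemma step_scal_neq0 Q : generic q t d1 d4 Q -> step_scal m n q d1 d4 Q != 0.
Proof.
move=> gen; have gen' := generic_q gen.
rewrite /step_scal mulf_neq0 //; last exact: (gen_Dy m n gen').
by have := gen_s m n gen 0; rewrite expr0 mul1r.
Qed.

(** The scalar identity behind [vcoef_step], with z = q^i, N = q^n, K = q^(m-i), so that z K = q^m;
    L is y and a is d1 / q^(m+1). The left side collects the scalars and the ratio v_i(q Q) /
    v_i(Q), the right side is [theta]. *)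
Lemma theta_field (Q z N K : F) : q != 0 -> d1 != 0 -> z != 0 -> N != 0 -> K != 0 ->
  1 - q != 0 ->
  1 - Q * (q ^+ 2 * z ^+ 2) != 0 ->
  1 - Q * (d4 * q / N) != 0 ->
  1 - Q * (q ^+ 2 * z / d1) != 0 ->
  1 - Q * (q * z / N) != 0 ->
  1 - Q * (q ^+ 2 / (N * d1)) != 0 ->
  1 - Q * (q ^+ 2 * z * K / d1) != 0 ->
  1 - Q * (q * z ^+ 2) != 0 ->
  let L := z * K * q ^+ 2 / d1 * Q in
  let a := d1 / (z * K) / q in
  (1 - L / (z * N * K)) * (1 - L * a * (d4 / N)) *
  ((1 - Q * (q ^+ 2 * z * K / d1)) / (1 - Q * (q ^+ 2 / (N * d1)))) *
  ((1 - Q * (q ^+ 2 * z ^+ 2) * K) / (1 - Q * (q ^+ 2 * z ^+ 2)) *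
   ((1 - Q * (d4 * q / N) * (z * N)) / (1 - Q * (d4 * q / N)))) /
  ((1 - Q * (q ^+ 2 * z / d1) * K) / (1 - Q * (q ^+ 2 * z / d1)) *
   ((1 - Q * (q * z / N) * (z * N)) / (1 - Q * (q * z / N)))) =
  1 + L ^+ 2 * a * (d4 / N) - L * (((z * K)^-1 + d1 + a * (N^-1 + d4)) * z - (1 + q) * a * z ^+ 2) +
  q * (1 - K^-1) * (1 - d1 * z) / ((1 - q) * (1 - Q * (q ^+ 2 * z ^+ 2))) *
    (- (a / q) * L ^+ 2 * ((q * z - N^-1) * (q * z - d4))) -
  q * (q * (1 - (q * K)^-1) * (1 - d1 * (z / q)) / ((1 - q) * (1 - Q * (q * z ^+ 2))) *
    (- (a / q) * L ^+ 2 * ((z - N^-1) * (z - d4)))).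
Proof.
move=> q0 d10 z0 N0 K0 q1 n1 n2 n3 n4 n5 n6 n7 L a; rewrite /L /a.
have clr b x : b != 0 -> 1 - Q * (x / b) != 0 -> b - Q * x != 0.
  by move=> b0 h; rewrite (_ : _ - _ = b * (1 - Q * (x / b))) ?mulf_neq0 //; field.
have m2 := clr _ _ N0 n2; have m3 := clr _ _ d10 n3; have m4 := clr _ _ N0 n4.
have m5 := clr _ _ (mulf_neq0 N0 d10) n5.
have m6 : d1 - Q * (q ^+ 2 * z) * K != 0 by rewrite -mulrA; apply: clr.
have m1 : 1 - Q * (q * z) ^+ 2 != 0 by rewrite exprMn.
by field; rewrite N0 d10 q0 K0 z0 n7 q1 m1 m4 m3 m6 m2 m5.
Qed.

(** The same first-order q-difference equation in Q as in [Cval_step]. *)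
Lemma vcoef_step Q (i : 'I_M.+1) : generic q t d1 d4 Q ->
  step_scal m n q d1 d4 Q * vcoef q d1 d4 m n (idx i) (q * Q) =
  Dp.[yof Q] * vcoef q d1 d4 m n (idx i) Q * theta m n q d1 d4 Q i.
Proof.
move=> gen; have gen' := generic_q gen; have q0 := gen_q0 gen; have d10 := gen_d10 gen.
have iM : (i <= M)%N by rewrite -ltnS.
rewrite (vcoefE _ gen) (vcoefE _ gen').
have hden := vden_neq0 i gen.
rewrite /step_scal -/Dp -/yof.
have sh b k : 1 - Q * b != 0 ->
    (pochX q b k).[q * Q] = (pochX q b k).[Q] * ((1 - Q * b * q ^+ k) / (1 - Q * b)).
  by move=> h; rewrite !horner_pochX_qpoch -mulrA qpoch_shiftV // mulrA.
have hA := expf_neq0 i q0; have hN := expf_neq0 n q0; have hK := expf_neq0 (M - i) q0.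
have eM : q ^+ M = q ^+ i * q ^+ (M - i) by rewrite -exprD subnKC.
have em : q ^+ m = q ^+ i * q ^+ (M - i) / q ^+ n.
  by rewrite -eM exprD mulrAC divff // mul1r.
pose z := q ^+ i / q ^+ n.
have n1 : 1 - Q * (q ^+ 2 * z ^+ 2) != 0.
  apply: (gen_neq0 (a := 2 + (i%:Z - n%:Z) * 2) (b := 0) (d := 0)) => //.
  rewrite !expr0z !mulr1 expfzDr // -exprz_exp [q ^ (i%:Z - _)]expfzDr // -exprnN -!exprnP.
  by rewrite /z.
have n2 : 1 - Q * (d4 * q / q ^+ n) != 0.
  apply: (gen_neq0 (a := 1 - n%:Z) (b := 0) (d := 1)) => //.
  by rewrite expr0z mulr1 expfzDr // -exprnN -!exprnP !expr1; ring.
have n3 : 1 - Q * (q ^+ 2 * z / d1) != 0.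
  apply: (gen_neq0 (a := 2 + i%:Z - n%:Z) (b := -1) (d := 0)) => //.
  by rewrite expr0z mulr1 exprN1 !expfzDr // -exprnN -!exprnP /z; ring.
have n4 : 1 - Q * (q * z / q ^+ n) != 0.
  apply: (gen_neq0 (a := 1 + i%:Z - n%:Z - n%:Z) (b := 0) (d := 0)) => //.
  by rewrite !expr0z !mulr1 !expfzDr // -exprnN -!exprnP expr1 /z; ring.
have n5 : 1 - Q * (q ^+ 2 / (q ^+ n * d1)) != 0.
  apply: (gen_neq0 (a := 2 - n%:Z) (b := -1) (d := 0)) => //.
  by rewrite expr0z mulr1 exprN1 !expfzDr // -exprnN -!exprnP; field; rewrite d10 hN.
have n6 : 1 - Q * (q ^+ 2 * z * q ^+ (M - i) / d1) != 0.
  apply: (gen_neq0 (a := 2 + i%:Z - n%:Z + (M - i)%N%:Z) (b := -1) (d := 0)) => //.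
  by rewrite expr0z mulr1 exprN1 !expfzDr // -exprnN -!exprnP /z; ring.
have n7 : 1 - Q * (q * z ^+ 2) != 0.
  apply: (gen_neq0 (a := 1 + (i%:Z - n%:Z) * 2) (b := 0) (d := 0)) => //.
  rewrite !expr0z !mulr1 expfzDr // -exprz_exp [q ^ (i%:Z - _)]expfzDr // -exprnN -!exprnP.
  by rewrite expr1 /z.
have q1 := gen_1q gen.
have hD : Dp.[yof (q * Q)] = Dp.[yof Q] *
    ((1 - Q * (q ^+ 2 * z * q ^+ (M - i) / d1)) / (1 - Q * (q ^+ 2 / (q ^+ n * d1)))).
  have -> : yof (q * Q) = q * yof Q by rewrite /yof mulrCA.
  rewrite !horner_pochX_qpoch.
  have ey : yof Q * q ^- M = Q * (q ^+ 2 / (q ^+ n * d1)).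
    rewrite /yof eM exprD em; field; rewrite d10 hN hA hK //.
rewrite -[q * yof Q * _]mulrA ey qpoch_shiftV // -mulrA; congr (_ * (_ / _)); rewrite eM /z.
  by field; rewrite d10 hN.
(* At i = 0 the closed formula does not describe [uval] at [i.-1], but there [ph_m] is 0 and the
   products agree. *)
have hu : uval m n q d1 (q * Q) i.-1 * ph_m q m n d1 d4 (yof Q) i =
    q * (1 - q ^+ i / (q * q ^+ M)) * (1 - d1 * (z / q)) / ((1 - q) * (1 - Q * (q * z ^+ 2))) *
    ph_m q m n d1 d4 (yof Q) i.
  case ei: (nat_of_ord i) => [|k]; first by rewrite /ph_m om_m0 !mulr0.
  congr (_ * _); rewrite /uval /z ei /= (exprS q k); have := n7; rewrite /z ei (exprS q k) => n7'.
  have hk := expf_neq0 k q0; have hM := expf_neq0 M q0.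
  move: hk hM hN q1 n7'; move: (q ^+ k) (q ^+ n) (q ^+ M) => P N MM hk hM hN q1 n7'.
  have e1 : 1 - q * Q * q ^+ 2 * (P / N) ^+ 2 = 1 - Q * (q * (q * P / N) ^+ 2) by ring.
  rewrite e1; move: n7'; set den := 1 - Q * _ => n7'.
  by field; rewrite n7' q1 hM hN q0.
rewrite /theta -mulrA -[q * _ * ph_m _ _ _ _ _ _ _]mulrA hu.
rewrite /vnum /vden !hornerM !sh // hD.
rewrite /vden !hornerM mulf_eq0 negb_or in hden; case/andP: hden => h1 h2.
move: h1 h2; set p1 := (pochX q _ _).[Q]; set p2 := (pochX q _ _).[Q] => h1 h2.
set p3 := (pochX q _ _).[Q]; set p4 := (pochX q _ _).[Q].
have z0 : z != 0 by rewrite mulf_neq0 ?invr_eq0.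
have eA : q ^+ i = z * q ^+ n by rewrite /z divfK.
have ez : q ^+ i / q ^+ n = z by [].
have := theta_field q0 d10 z0 hN hK q1 n1 n2 n3 n4 n5 n6 n7.
set L := z * _ * _ / _ * _; set a := d1 / _ / _ => /= key.
have em' : q ^+ m = z * q ^+ (M - i) by rewrite em eA; field.
have eL : yof Q = L by rewrite /yof /L exprD em'.
rewrite /Rscal1 /Rscal2 -/(yof Q) !eL eM !ez !eA em' -/a.
transitivity (Dp.[L] * (vconst i * (p1 * p2) / (p3 * p4)) *
  ((1 - L / (z * q ^+ n * q ^+ (M - i))) * (1 - L * a * (d4 / q ^+ n)) *
  ((1 - Q * (q ^+ 2 * z * q ^+ (M - i) / d1)) / (1 - Q * (q ^+ 2 / (q ^+ n * d1)))) *
  ((1 - Q * (q ^+ 2 * z ^+ 2) * q ^+ (M - i)) / (1 - Q * (q ^+ 2 * z ^+ 2)) *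
   ((1 - Q * (d4 * q / q ^+ n) * (z * q ^+ n)) / (1 - Q * (d4 * q / q ^+ n)))) /
  ((1 - Q * (q ^+ 2 * z / d1) * q ^+ (M - i)) / (1 - Q * (q ^+ 2 * z / d1)) *
   ((1 - Q * (q * z / q ^+ n) * (z * q ^+ n)) / (1 - Q * (q * z / q ^+ n)))))).
  rewrite !invfM. ring.
rewrite key; congr (_ * _).
rewrite /pm_0 /uval /ph_m /om_m /om_0 (exprS q i) em' eM -/a !eA.
have f1 : z * q ^+ n / q ^+ n = z by rewrite mulfK.
have f2 : q * (z * q ^+ n) / q ^+ n = q * z by rewrite mulrA mulfK.
have f3 : z * q ^+ n / (z * q ^+ n * q ^+ (M - i)) = (q ^+ (M - i))^-1.
  by field; rewrite hN hK z0.
have f4 : z * q ^+ n / (q * (z * q ^+ n * q ^+ (M - i))) = (q * q ^+ (M - i))^-1.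
  by field; rewrite hN hK z0 q0.
by rewrite f3 f4 f2 !f1 -[Q * q ^+ 2 * _]mulrA.
Qed.

(** Taking leading minors of [connection] removes the unitriangular factors; the sizes i and i + 1
    differ by the single diagonal entry C_i. No minor is divided by. *)
Lemma minor_step Q (i : 'I_M.+1) : generic q t d1 d4 Q ->
  c ^+ i * \det (lead_mx i.+1 (Rval q m n d1 d4 (yof Q))) =
  Dp.[yof Q] * Cval q t d1 d4 Y Q i * \det (lead_mx i (Rval q m n d1 d4 (yof Q))).
Proof.
move=> gen; set R := Rval _ _ _ _ _ _.
have c0 : c != 0 by rewrite mulf_neq0 ?invr_eq0 ?expf_neq0 ?(gen_q0 gen) ?(gen_d10 gen).
have [Wl W1] := Wmx_lower1 hY gen; have [Ul U1] := Umx_upper1 hY gen.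
have El (a b : 'I_M.+1) : (a < b)%N -> powdiag m n c a b = 0.
  move=> lt; rewrite /powdiag !mxE (_ : (a == b) = false) ?mulr0n //.
  by apply/negbTE; apply: contraTneq lt => ->; rewrite ltnn.
pose G : 'M[F]_M.+1 := diag_mx (\row_a (Dp.[yof Q] * Cval q t d1 d4 Y Q a)).
have Gl (a b : 'I_M.+1) : (a < b)%N -> G a b = 0.
  move=> lt; rewrite !mxE (_ : (a == b) = false) ?mulr0n //.
  by apply/negbTE; apply: contraTneq lt => ->; rewrite ltnn.
have main k : (k <= M.+1)%N ->
    (\prod_(j < k) c ^+ (inord j : 'I_M.+1)) * \det (lead_mx k R) =
    \prod_(j < k) (Dp.[yof Q] * Cval q t d1 d4 Y Q (inord j)).
  move=> le; have := connection hY gen; rewrite -/c -/Dp -/R -/(yof Q).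
  rewrite (_ : _ *: _ = G *m Umx Y Q); last first.
    by apply/matrixP => a b; rewrite mul_diag_mx !mxE mulrA.
  move/(congr1 (fun A => \det (lead_mx k A))).
  rewrite (lead_mul_lower _ le Wl) (lead_mul_lower _ le El) (lead_mul_upper _ le Ul).
  rewrite !det_mulmx (det_lead_lower le Wl) (det_lead_lower le El).
  rewrite (det_lead_lower le Gl) (det_lead_upper le Ul).
  have -> : \prod_(j < k) Wmx t Y Q (inord j) (inord j) = 1.
    by apply: big1 => j _; rewrite W1.
  have -> : \prod_(j < k) Umx Y Q (inord j) (inord j) = 1.
    by apply: big1 => j _; rewrite U1.
  rewrite mul1r mulr1.
  move=> e; transitivity ((\prod_(j < k) powdiag m n c (inord j) (inord j)) * \det (lead_mx k R)).
    by congr (_ * _); apply: eq_bigr => j _; rewrite !mxE eqxx mulr1n.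
  by rewrite e; apply: eq_bigr => j _; rewrite !mxE eqxx mulr1n.
have := main i.+1 (ltn_ord i); rewrite !big_ord_recr /= inord_val.
rewrite -(main i (ltnW (ltn_ord i))) => e.
apply: (@mulfI _ (\prod_(j < i) c ^+ (inord j : 'I_M.+1))).
  by apply/prodf_neq0 => j _; rewrite expf_neq0.
by rewrite mulrA e; ring.
Qed.

Lemma Cval_vcoef_iter Q (i : 'I_M.+1) k : generic q t d1 d4 Q ->
  Cval q t d1 d4 Y (q ^+ k * Q) i * vcoef q d1 d4 m n (idx i) Q =
  Cval q t d1 d4 Y Q i * vcoef q d1 d4 m n (idx i) (q ^+ k * Q).
Proof.
move=> gen; elim: k => [|k IH]; first by rewrite expr0 mul1r.
have genk := generic_qX gen k; rewrite exprS -mulrA; set Qk := q ^+ k * Q in genk IH *.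
apply: (mulfI (step_scal_neq0 genk)).
rewrite mulrA (Cval_step hY i genk) mulrAC [in LHS]mulrAC -[_ * Cval _ _ _ _ _ _ _ * _]mulrA.
rewrite [RHS]mulrCA (vcoef_step i genk) -/Dp -/yof.
transitivity (Dp.[yof Qk] * theta m n q d1 d4 Qk i *
  (Cval q t d1 d4 Y Qk i * vcoef q d1 d4 m n (idx i) Q)); first by ring.
by rewrite IH; ring.
Qed.

Lemma Rval0_upper (a b : 'I_M.+1) Q : generic q t d1 d4 Q -> (b < a)%N ->
  Rval q m n d1 d4 0 a b = 0.
Proof.
by move=> gen lt; rewrite -horner_Rmx horner_coef0 -(r_coef0 gen) r_coef0_lower.
Qed.

Lemma Rval0_diag (a : 'I_M.+1) Q : generic q t d1 d4 Q ->
  Rval q m n d1 d4 0 a a = q ^ (idx a * (idx a + 1)).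
Proof.
by move=> gen; rewrite -horner_Rmx horner_coef0 -(r_coef0 gen) (r_coef0_diag gen).
Qed.

Lemma horner_det_lead k L :
  (\det (lead_mx k (Rmx q m n d1 d4))).[L] = \det (lead_mx k (Rval q m n d1 d4 L)).
Proof.
rewrite -[LHS]/(horner_eval L _) -det_map_mx; congr (\det _).
by apply/matrixP => a b; rewrite !mxE.
Qed.

(* Both sides of minor_step are rational in Q, and by Cval_vcoef_iter the ratio
   Cval / vcoef is the same at all q^k Q, so it can be evaluated at Q = 0. *)
Lemma Cval_vcoef Q (i : 'I_M.+1) : generic q t d1 d4 Q ->
  Cval q t d1 d4 Y Q i = c ^+ n * vcoef q d1 d4 m n (idx i) Q.
Proof.
move=> gen; have q0 := gen_q0 gen; have d10 := gen_d10 gen.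
have c0 : c != 0 by rewrite mulf_neq0 ?invr_eq0 ?expf_neq0.
have iM : (i <= M.+1)%N by rewrite ltnW.
set v := vcoef _ _ _ _ _ _ _; set C := Cval _ _ _ _ _ _ _.
pose dP k := \det (lead_mx k (Rmx q m n d1 d4)) \Po ((q ^+ (m + 2) / d1) *: 'X).
have dPE k X : (dP k).[X] = \det (lead_mx k (Rval q m n d1 d4 (yof X))).
  by rewrite horner_comp hornerZ hornerX horner_det_lead.
(* [minor_step] at X, with C_i(X) replaced by (C / v) v_i(X) and denominators cleared, as a
   polynomial in X. *)
pose p := (c ^+ i * v) *: (dP i.+1 * vden i) -
  (C * vconst i) *: ((Dp \Po ((q ^+ (m + 2) / d1) *: 'X)) * dP i * vnum i).
have p0 : p = 0.
  apply: (poly_eq0_powers q0 (gen_hq gen) (gen_Q0 gen)) => k; set X := q ^+ k * Q.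
  have genk : generic q t d1 d4 X by exact: generic_qX.
  have it := Cval_vcoef_iter i k gen; rewrite -/X -/v -/C in it.
  have ms := minor_step i genk; have vd := vden_neq0 i genk.
  rewrite /p hornerD hornerN !hornerZ !hornerM !dPE horner_comp hornerZ hornerX -/(yof X).
  rewrite (vcoefE _ genk) in it.
  apply/eqP; rewrite subr_eq0; apply/eqP.
  transitivity ((c ^+ i * \det (lead_mx i.+1 (Rval q m n d1 d4 (yof X)))) * (v * (vden i).[X])).
    by rewrite /vden hornerM; ring.
  rewrite ms.
  transitivity ((Cval q t d1 d4 Y X i * v) * (vden i).[X] *
    (Dp.[yof X] * \det (lead_mx i (Rval q m n d1 d4 (yof X))))); first by ring.
  by rewrite it /vnum hornerM; field.
(* At X = 0 the matrix R is upper triangular with diagonal q^(i(i+1)), so the minors are nonzero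
   products, and all q-Pochhammer factors equal 1. *)
have := congr1 (fun r : {poly F} => r.[0]) p0.
rewrite /p hornerD hornerN !hornerZ !hornerM !dPE horner_comp hornerZ hornerX mulr0.
rewrite (_ : yof 0 = 0) ?horner_coef0 ?horner0; last by rewrite /yof mulr0.
have lowR (a b : 'I_M.+1) : (b < a)%N -> Rval q m n d1 d4 0 a b = 0.
  exact: Rval0_upper gen.
rewrite (det_lead_upper (ltn_ord i) lowR) (det_lead_upper iM lowR) big_ord_recr /= inord_val.
set pr := \prod_(j < i) _; rewrite (Rval0_diag i gen).
have pr0 : pr != 0.
  by apply/prodf_neq0 => j _; rewrite (Rval0_diag _ gen) expfz_neq0.
rewrite den_coef0 -!horner_coef0 !horner_pochX_qpoch !mul0r.
have q00 k : qpoch 0 q k = 1.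
  by rewrite /qpoch big1 // => s _; rewrite mul0r subr0.
rewrite !q00 horner0 !mulr1 mul1r /vconst => /eqP; rewrite subr_eq0 => /eqP e.
have T0 : q ^ (idx i * (idx i + 1)) != 0 by rewrite expfz_neq0.
have ci := expf_neq0 i c0; have cn := expf_neq0 n c0.
move: T0 e; move: (q ^ _) => T T0 e.
apply: (mulIf (mulf_neq0 ci (mulf_neq0 pr0 T0))).
transitivity (c ^+ n * (C * (T * (c ^+ i / c ^+ n)) * pr)); first by field.
by rewrite -e; ring.
Qed.

End Final.

(** * The equation in Q, coefficient by coefficient *)

Theorem proposition3p6 (F : fieldType) (m n : nat) (q t d1 d4 : F)
    (Y : F -> 'I_(n + m).+1 -> 'I_(n + m).+1 -> nat -> F)
    (hY : forall Q : F, generic q t d1 d4 Q ->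
       normalized_fundamental_solution q t d1 d4 Q (Y Q)) :
  forall Q : F, generic q t d1 d4 Q ->
  forall (i k : 'I_(n + m).+1) (N : int),
    \sum_(j : 'I_(n + m).+1)
      laurent ((d1 / q ^+ (m + 2)) ^ idx j *
               rtilde q d1 d4 m n (idx j) (idx k) Q)
        (idx j) (Y (Q / t) i j) N
    = laurent (vcoef q d1 d4 m n (idx i) Q) (idx i) (Y Q i k) N.
Proof.
move=> Q gen i k N; set c := d1 / q ^+ (m + 2).
have c0 : c != 0.
  by rewrite mulf_neq0 ?invr_eq0 ?expf_neq0 ?(gen_q0 gen) ?(gen_d10 gen).
(* Exponents are shifted by n to become natural; below Lambda^-n both sides vanish, as every index
   is at least -n. *)
case eN: (N + n%:Z) => [N'|N']; last first.
  have L0 a (j : 'I_(n + m).+1) f : laurent a (idx j) f N = 0 :> F.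
    by rewrite /laurent; case e: (N - idx j) => [p|p] //; move: e; rewrite /idx; lia.
  by rewrite L0 big1 // => j _; rewrite L0.
have LE a (j : 'I_(n + m).+1) f : laurent a (idx j) f N = a * psshift j f N' :> F.
  rewrite /laurent /psshift; case: leqP => h.
    by have -> : N - idx j = Posz (N' - j) by rewrite /idx; lia.
  by case e: (N - idx j) => [p|p]; rewrite ?mulr0 //; move: e; rewrite /idx; lia.
(* The factor c^-n undoes the normalization of [Xser], whose powers of c are indexed from 0; it
   cancels the c^n of [Cval_vcoef]. *)
rewrite LE; transitivity (c ^- n * Xser q t d1 d4 Q Y i k N').
  rewrite /Xser mulr_sumr; apply: eq_bigr => j _.
  rewrite LE (rtildeE gen) /idx expfzDr // -exprnN -/c.
  by rewrite -exprnP; ring.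
rewrite (Xser_Y gen hY) -[Xser _ _ _ _ _ _ _ _ _]/(Cval q t d1 d4 Y Q i).
by rewrite (Cval_vcoef hY i gen) -/c mulrA mulKf // expf_neq0.
Qed.
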